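(* Let $\mathfrak{p}$ and $\mathfrak{b}$ be two freely independent elements in a non-commutative probability space $(\mathcal{A},\varphi)$ with unit $\mathbf{1}_{\mathcal{A}}$ such that $\mathfrak{p}\mathfrak{b}$ and $\mathfrak{p}(\mathbf{1}_{\mathcal{A}}-\mathfrak{b})$ are freely independent. (a) If $\mathfrak{b}$ is a Bernoulli variable with parameter $p\in(0,1)$ and $\varphi(\mathfrak{p})>0$, then $\mathfrak{p}$ is free Poisson with rate $1$ and jump size $\varphi(\mathfrak{p})$. (b) If $\mathfrak{p}$ is a free Poisson variable with rate $1$, then $\varphi(\mathfrak{b}^n)=\varphi(\mathfrak{b})$ for all $n\ge1$. If, further, there is a probability measure $\nu$ on $\mathbb{R}$ with $\varphi(\mathfrak{b}^n)=\int x^n\,d\nu(x)$ for all $n\ge1$, then $\mathfrak{b}$ is a Bernoulli variable with parameter $p=\nu(\{1\})$. Moreover, (still with $\mathfrak{p}$ free Poisson with rate $1$) if $(\mathcal{A},\varphi)$ is a $*$-probability space with $\varphi$ faithful and $\mathfrak{b}$ is self-adjoint, then $\mathfrak{b}$ is a projection.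
   Context: A non-commutative probability space is a pair $(\mathcal{A},\varphi)$ with $\mathcal{A}$ a unital algebra over $\mathbb{C}$ and $\varphi:\mathcal{A}\to\mathbb{C}$ linear with $\varphi(\mathbf{1}_{\mathcal{A}})=1$. It is a $*$-probability space if $\mathcal{A}$ is a $*$-algebra and $\varphi(a^*a)\ge0$ for all $a$; $\varphi$ is faithful if $\varphi(a^*a)=0$ only for $a=0$. A projection is a self-adjoint idempotent. Unital subalgebras $(\mathcal{A}_i)_{i\in I}$ are freely independent (free) if $\varphi(a_1\cdots a_k)=0$ whenever $k\ge1$, $a_j\in\mathcal{A}_{i_j}$, $\varphi(a_j)=0$ for all $j$, and $i_1\ne i_2,\ldots,i_{k-1}\ne i_k$. Elements are free if the unital subalgebras they generate are free. Free cumulants $\kappa_n:\mathcal{A}^n\to\mathbb{C}$ are the multilinear functionals determined by $\varphi(a_1\cdots a_n)=\sum_{\pi\in NC(n)}\prod_{V\in\pi}\kappa_{|V|}(a_{i}:i\in V)$ (indices in each block in increasing order), where $NC(n)$ is the set of non-crossing partitions of $\{1,\ldots,n\}$; $\kappa_n(a):=\kappa_n(a,\ldots,a)$. $\mathfrak{p}\in\mathcal{A}$ is free Poisson with rate $\lambda>0$ and jump size $\alpha>0$ if $\kappa_n(\mathfrak{p})=\lambda\alpha^n$ for all $n\ge1$; it is free Poisson with rate $\lambda$ if this holds for some $\alpha>0$. $\mathfrak{b}\in\mathcal{A}$ is a Bernoulli variable with parameter $p\in[0,1]$ if $\varphi(\mathfrak{b}^n)=p$ for all $n\ge1$. *)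

(* Defs.v *)
From HB Require Import structures.
From mathcomp Require Import all_boot all_order all_algebra.
From mathcomp Require Import complex.
From mathcomp Require Import all_classical all_reals all_analysis.

Set Implicit Arguments.
Unset Strict Implicit.
Unset Printing Implicit Defensive.

Import Order.TTheory GRing.Theory Num.Theory.

Local Open Scope classical_set_scope.
Local Open Scope ring_scope.
Local Open Scope complex_scope.

(* The scalar field is R[i] for an arbitrary realType R.  In the order of R[i],
   0 <= z (resp. 0 < z) means that z is real and nonnegative (resp. positive). *)

Section FreeIndependence.
Context {R : realType} {A : algType R[i]}.

Definition unital_subalgebra : set (set A) :=
  [set B : set A | GRing.subalg_closed (mem B)].

Definition generated_subalgebra (S : set A) : set A :=
  smallest unital_subalgebra S.

Definition free_subalgebras (phi : A -> R[i]) (I : Type) (B : I -> set A) :=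
  forall (k : nat) (i : 'I_k -> I) (a : 'I_k -> A),
    (0 < k)%N ->
    (forall j, B (i j) (a j)) ->
    (forall j, phi (a j) = 0) ->
    (forall j j' : 'I_k, j' = j.+1 :> nat -> i j <> i j') ->
    phi (\prod_(j < k) a j) = 0.

Definition free_elements (phi : A -> R[i]) (I : Type) (x : I -> A) :=
  free_subalgebras phi (fun i => generated_subalgebra [set x i]).

Definition free_pair (phi : A -> R[i]) (x y : A) :=
  free_elements phi (fun c : bool => if c then x else y).

End FreeIndependence.

Section NonCrossing.
Local Open Scope nat_scope.

Definition crossing (n : nat) (V W : {set 'I_n}) : bool :=
  [exists i in V, exists j in W, exists k in V, exists l in W,
    (i < j < k) && (k < l)].

Definition NC (n : nat) : {set {set {set 'I_n}}} :=
  [set P | finset.partition P [set: 'I_n] &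
    [forall V in P, forall W in P, (V != W) ==> ~~ crossing V W]]%SET.

End NonCrossing.

Section FreeCumulants.
Context {R : realType} {A : algType R[i]}.
Variable phi : A -> R[i].

(* The tuple (a_i : i in V), indices in increasing order. *)
Definition restrict_block (n : nat) (a : 'I_n -> A) (V : {set 'I_n}) :
  'I_#|V| -> A := fun j => a (enum_val j).

(* The moment-cumulant formula solved for the term of the one-block partition;
   m bounds the depth of the recursion, and any m >= n gives the same value. *)
Fixpoint free_cumulant_rec (m n : nat) (a : 'I_n -> A) {struct m} : R[i] :=
  if m is m'.+1 then
    phi (\prod_(i < n) a i) -
    \sum_(P in NC n | P != [set [set: 'I_n]]%SET)
      \prod_(V in P) free_cumulant_rec m' (@restrict_block n a V)
  else 0.

Definition free_cumulant (n : nat) (a : 'I_n -> A) : R[i] :=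
  free_cumulant_rec n a.

Lemma NC_block n (P : {set {set 'I_n}}) (V : {set 'I_n}) :
  P \in NC n -> P != [set [set: 'I_n]]%SET -> V \in P -> (0 < #|V| < n)%N.
Proof.
rewrite inE => /andP[/and3P[/eqP cP tP nP] _] PT VP.
have Vn0 : V != finset.set0 by apply: contraNneq nP => <-.
rewrite card_gt0 Vn0 /= -[X in (_ < X)%N]card_ord -cardsT.
apply: proper_card; rewrite properT; apply: contraNneq PT => VT.
rewrite finset.eqEsubset finset.sub1set -VT VP andbT.
apply/fintype.subsetP => W WP; rewrite finset.in_set1; apply: contraT => WV.
have /finset.trivIsetP/(_ W V WP VP WV) := tP.
rewrite VT finset.disjoints_subset finset.setCT finset.subset0 => /eqP W0.
by rewrite W0 (negbTE (_ : _ \notin _)) // in WP.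
Qed.

Lemma NC_one_block n : (0 < n)%N -> [set [set: 'I_n]]%SET \in NC n.
Proof.
move=> n0; rewrite inE; apply/andP; split.
  apply/and3P; split.
  - by rewrite /finset.cover finset.big_set1.
  - by apply/finset.trivIsetP => V W /finset.set1P-> /finset.set1P->; rewrite eqxx.
  - by rewrite finset.in_set1 eq_sym -card_gt0 cardsT card_ord.
apply/forall_inP => V /finset.set1P->; apply/forall_inP => W /finset.set1P->.
by rewrite eqxx.
Qed.

Lemma free_cumulant_rec_fuel m m' n (a : 'I_n -> A) :
  (0 < n <= m)%N -> (0 < n <= m')%N ->
  free_cumulant_rec m a = free_cumulant_rec m' a.
Proof.
elim: m m' n a => [|m IH] [|m'] n a /andP[n0 nm] /andP[_ nm'] //=;
  rewrite ?(leq_trans n0) // in nm nm' *.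
- by move: (leq_trans n0 nm).
- by move: (leq_trans n0 nm').
congr (_ - _); apply: eq_bigr => P /andP[PN PT].
apply: eq_bigr => V VP; have /andP[V0 Vn] := NC_block PN PT VP.
apply: IH; rewrite V0 /= -ltnS; exact: leq_trans Vn _.
Qed.

Lemma restrict_blockT (k : forall n, ('I_n -> A) -> R[i]) n (a : 'I_n -> A) :
  k _ (@restrict_block n a [set: 'I_n]%SET) = k n a.
Proof.
have e : #|[set: 'I_n]%SET| = n by rewrite cardsT card_ord.
have -> : @restrict_block n a [set: 'I_n]%SET = fun j => a (cast_ord e j).
  apply/funext => j; congr (a _); apply: val_inj => /=.
  rewrite /enum_val finset.enum_setT -enumT nth_enum_ord //.
  by rewrite -[X in (_ < X)%N]e.
move: e; set m := #|_| => e; move: m e => m e.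
by case: n / e a => a; congr (k _ _); apply/funext => j; rewrite cast_ord_id.
Qed.

Lemma moment_cumulant n (a : 'I_n -> A) : (0 < n)%N ->
  phi (\prod_(i < n) a i) =
  \sum_(P in NC n) \prod_(V in P) free_cumulant (@restrict_block n a V).
Proof.
move=> n0; rewrite (bigD1 [set [set: 'I_n]]%SET) ?NC_one_block //=.
rewrite finset.big_set1 (restrict_blockT free_cumulant).
rewrite [free_cumulant a]/free_cumulant; case: n a n0 => // n a _ /=.
set S := (X in _ - X); set T := (X in _ + X).
suff -> : S = T by rewrite subrK.
apply: eq_bigr => P /andP[PN PT].
apply: eq_bigr => V VP; have /andP[V0 Vn] := NC_block PN PT VP.
by apply: free_cumulant_rec_fuel; rewrite V0 //= -ltnS.
Qed.

Lemma free_cumulant_unique (k : forall n, ('I_n -> A) -> R[i]) :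
  (forall n (a : 'I_n -> A), (0 < n)%N ->
     phi (\prod_(i < n) a i) =
     \sum_(P in NC n) \prod_(V in P) k _ (@restrict_block n a V)) ->
  forall n (a : 'I_n -> A), (0 < n)%N -> k n a = free_cumulant a.
Proof.
move=> Hk n; elim/ltn_ind: n => n IH a n0.
have := Hk n a n0; rewrite (moment_cumulant a n0).
rewrite (bigD1 [set [set: 'I_n]]%SET) ?NC_one_block //=.
rewrite [RHS](bigD1 [set [set: 'I_n]]%SET) ?NC_one_block //=.
rewrite !finset.big_set1 (restrict_blockT free_cumulant) (restrict_blockT k).
set S := (X in _ + X = _); set T := (X in _ = _ + X).
suff -> : S = T by move/addIr.
apply: eq_bigr => P /andP[PN PT].
apply: eq_bigr => V VP; have /andP[V0 Vn] := NC_block PN PT VP.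
by rewrite IH.
Qed.

End FreeCumulants.

Section Variables.
Context {R : realType} {A : algType R[i]}.
Variable phi : A -> R[i].

Definition free_poisson (x : A) (lambda alpha : R[i]) :=
  [/\ 0 < lambda, 0 < alpha &
    forall n, (0 < n)%N ->
      free_cumulant phi (fun _ : 'I_n => x) = lambda * alpha ^+ n].

Definition free_poisson_rate (x : A) (lambda : R[i]) :=
  exists alpha, free_poisson x lambda alpha.

Definition bernoulli_variable (x : A) (p : R) :=
  0 <= p <= 1 /\ forall n, (0 < n)%N -> phi (x ^+ n) = p%:C.

(* The moments of nu are finite and agree with those of x. *)
Definition has_moments_of (x : A) (nu : probability (measurableTypeR R) R) :=
  forall n, (0 < n)%N ->
    nu.-integrable setT (fun t : measurableTypeR R => ((t : R) ^+ n)%:E) /\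
    phi (x ^+ n) = (Rintegral nu setT (fun t : measurableTypeR R => (t : R) ^+ n))%:C.

End Variables.

Section StarAlgebra.
Context {R : realType} {A : algType R[i]}.

Record star_operation (star : A -> A) : Prop := StarOperation {
  star_involutive : involutive star;
  star_additive : {morph star : x y / x + y};
  star_antilinear : forall (c : R[i]) x, star (c *: x) = c^* *: star x;
  star_antimultiplicative : forall x y, star (x * y) = star y * star x }.

Definition star_positive (star : A -> A) (phi : A -> R[i]) :=
  forall x, 0 <= phi (star x * x).

Definition star_faithful (star : A -> A) (phi : A -> R[i]) :=
  forall x, phi (star x * x) = 0 -> x = 0.

Definition self_adjoint (star : A -> A) (x : A) := star x = x.

Definition projection (star : A -> A) (x : A) :=
  self_adjoint star x /\ x * x = x.

End StarAlgebra.

(* Main.v *)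
Require Import Defs.
From HB Require Import structures.
From mathcomp Require Import all_boot all_order all_algebra.
From mathcomp Require Import complex.
From mathcomp Require Import ring zify.
From mathcomp Require Import all_classical all_reals all_analysis.
From mathcomp Require Import measurable_realfun.

Set Implicit Arguments.
Unset Strict Implicit.
Unset Printing Implicit Defensive.

(** Put [u = x b] and [v = x (1 - b)], so that [x = u + v], and let
    [U = sum_n z^n u^n] be the resolvent series of [u].  The proof is a
    computation with the power series
      [N_r = phi (x^r U)],  [L_r = phi (b^r U)],  [M = N_0 = L_0],  [H = L_1],
    whose constant terms are the moments [m_r = phi (x^r)] and
    [be_r = phi (b^r)].  Write [al = phi x] and [p = phi b].

    Freeness of [x] and [b] enters through a linear identity that does not
    involve their laws. Let [delta] be the derivation, with values in the
    tensor square, that kills [x] and sends [b] to [b ⊗ 1 - 1 ⊗ b]. Then [(phi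
    ⊗ phi) (delta w) = 0] for every word [w]: this is Voiculescu's liberation
    identity (lemma [liberation]). It is multilinear in the letters of [w] and
    compatible with merging letters, hence it suffices to check it on
    alternating products of centred letters, where every term contains a
    factor that freeness makes zero. On the words [x^r u^n] and [b^r u^n], and
    with the traciality of [phi] on the algebra generated by [x] and [b], it
    becomes
      [(N_r - m_r) M = z H N_(r+1)]   and   [(M - 1) L_(r+1) = (L_r - be_r) H]
    (lemmas [moment_series_powx] and [moment_series_powb]). These two
    recursions are the substitution rules [M = sum_r m_r s^r = sum_r be_r t^r]
    of the multiplicative free convolution, with [s = z H / M] and [t = (M -
    1) / H], but they ask for no composition of series. The only consequence
    of the freeness of [u] and [v] that is used is [phi (u^n v) = phi (u^n)
    phi (v)], that is
      [z N_1 = M - 1 + al (1 - p) z M]   (lemma [split_series]).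

    Since the cumulants [al^n] give [m_n] as [al^n] times the number of
    non-crossing partitions, which obeys the Catalan recursion, [x] is free
    Poisson of rate one and jump size [al > 0] iff
    [m_(r+1) = al sum_i m_i m_(r-i)] (lemma [geometric_cumulantsP]).

    (a) If [be_r = p] for [r >= 1], the second recursion forces [L_2 = L_1] and
    then [H = M - 1 + p].  Eliminating [N_1] between the other two relations
    gives [M - 1 = al z M H], so [N_1 = al M^2]; carried along the first
    recursion this is the Catalan recursion for the [m_r].

    (b) Conversely the Catalan recursion gives [N_1 = al M^2], hence
    [M - 1 = al z M H], and the split relation becomes [M - 1 = H - p].  When
    [p <> 0], the series [M - 1] can be cancelled in the second recursion,
    which then yields [L_r = H] for all [r >= 1], hence [be_r = p].  When
    [p = 0], the same argument applies to [1 - b], whose mean is [1]: the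
    hypotheses are symmetric in [b] and [1 - b].  The statements on measures
    and on projections follow by integrating [(t^2 - t)^2] and by
    evaluating [phi] at the square of [b^2 - b]. *)

(** * Counting non-crossing partitions *)

(* Membership facts and quantified hypotheses only slow the arithmetic solver
   down, so they are discarded first. *)
Ltac arith := repeat match goal with
  | H : is_true (_ \in _) |- _ => clear H
  | H : is_true (~~ (_ \in _)) |- _ => clear H
  | H : (_ /\ _) |- _ => clear H
  | H : forall _, _ |- _ => clear H
  end; lia.

Section NonCrossingCount.
Import boot.fintype boot.finset.
Local Open Scope nat_scope.
Variable N : nat.
Implicit Types (S U V W : {set 'I_N}) (P Q : {set {set 'I_N}}) (x y : 'I_N).

(** Partitions of an arbitrary subset of ['I_N], so that the pieces of a
    partition need no renumbering when it is cut in two. *)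
Definition nc_partitions S : {set {set {set 'I_N}}} :=
  [set P | partition P S &
    [forall V in P, forall W in P, (V != W) ==> ~~ crossing V W]].

(** A first-order form of non-crossing partitions, which turns the gluing
    and cutting arguments below into comparisons of indices. *)
Definition nc_spec P S := [/\ (forall U x, U \in P -> x \in U -> x \in S),
  (forall x, x \in S -> exists2 U, U \in P & x \in U),
  (forall U V x, U \in P -> V \in P -> x \in U -> x \in V -> U = V),
  (set0 \notin P) &
  (forall U V i j k l, U \in P -> V \in P -> U <> V ->
    i \in U -> j \in V -> k \in U -> l \in V -> i < j -> j < k -> k < l -> False)].

Lemma nc_partitionsP P S : reflect (nc_spec P S) (P \in nc_partitions S).
Proof.
rewrite inE; apply: (iffP andP) => [[/and3P[/eqP cP tP P0] nP]|[sub cov uni P0 ncr]].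
  split=> //.
  - by move=> U x UP xU; rewrite -cP; apply/bigcupP; exists U.
  - by move=> x; rewrite -cP => /bigcupP[U]; exists U.
  - by move=> U V x UP VP xU xV; rewrite -(def_pblock tP UP xU) (def_pblock tP VP xV).
  move=> U V i j k l UP VP UV iU jV kU lV ij jk kl.
  have /forall_inP/(_ U UP)/forall_inP/(_ V VP)/implyP/(_ _)/negP := nP.
  apply; first exact/eqP.
  apply/exists_inP; exists i => //; apply/exists_inP; exists j => //.
  apply/exists_inP; exists k => //; apply/exists_inP; exists l => //.
  by rewrite ij jk.
split.
  apply/and3P; split=> //.
    apply/eqP/setP => x; apply/bigcupP/idP => [[U UP]|/cov[U UP xU]].
      exact: sub.
    by exists U.
  apply/trivIsetP => U V UP VP UV; rewrite -setI_eq0; apply: contraNT UV.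
  by case/set0Pn=> x /setIP[xU xV]; apply/eqP/(uni U V x).
apply/forall_inP => U UP; apply/forall_inP => V VP; apply/implyP => /eqP UV.
apply/negP => /exists_inP[i iU] /exists_inP[j jV] /exists_inP[k kU].
move=> /exists_inP[l lV] /andP[/andP[ij jk] kl].
exact: (ncr U V i j k l).
Qed.

Definition segment a c : {set 'I_N} := [set i : 'I_N | a <= i < c].

Variables (a : nat) (last : 'I_N).
Hypothesis a_last : a <= last.

(** The recursion sorts the partitions of [a, last] by the element [j] that
    precedes [last] in its block; [gap_index] is [j - a + 1], and [0] when
    [last] is alone.  No block other than that of [last] can straddle [j], so
    the partition splits into one of [a, j] and one of the gap ]j, last[. *)
Definition gap_index P :=
  \max_(x in pblock P last :\ last) (x - a).+1.

Lemma pblock_eq P S U x : P \in nc_partitions S -> U \in P -> x \in U -> pblock P x = U.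
Proof. by rewrite inE => /andP[/and3P[_ tP _] _]; apply: def_pblock. Qed.

(** With this default value, [glue] below also covers the case where [last]
    is a singleton: then the lower partition is empty, and so is the block to
    which [last] is added. *)
Lemma pblock0 x : pblock set0 x = set0 :> {set 'I_N}.
Proof.
by rewrite /pblock; case: pickP => //= U; rewrite inE.
Qed.

Section Glue.
Variable i : nat.
Hypothesis i_last : a + i <= last.

Lemma mid_lt : (a + i).-1 < N. Proof. have := ltn_ord last; arith. Qed.
Definition mid : 'I_N := Ordinal mid_lt.

Definition glue (PQ : {set {set 'I_N}} * {set {set 'I_N}}) :=
  (last |: pblock PQ.1 mid) |: ((PQ.1 :\ pblock PQ.1 mid) :|: PQ.2).

Definition lower P := ((pblock P last :\ last)
   |: [set U in P | U \subset segment a (a + i)]) :\ set0.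
Definition upper P := [set U in P | U \subset segment (a + i) last].

(** [mid] is the predecessor of [last] in its block, hence it is meaningful
    only for [0 < i]. *)
Variant mid_block_spec P W : Prop :=
| MidEmpty of i = 0 & P = set0 & W = set0
| MidBlock of 0 < i & W \in P & mid \in W.

Lemma mid_blockP P : P \in nc_partitions (segment a (a + i)) ->
  mid_block_spec P (pblock P mid).
Proof.
move=> PN; have /nc_partitionsP[sub cov _ P0 _] := PN.
have [i0|i0] := posnP i.
  suff PE : P = set0 by apply: MidEmpty => //; rewrite PE pblock0.
  apply/setP => U; rewrite inE; apply/negP => UP.
  have /set0Pn[x xU] : U != set0 by apply: contraNneq P0 => <-.
  by have := sub _ _ UP xU; rewrite inE i0; arith.
have [|U UP mU] := cov mid; first by rewrite inE /=; arith.
by rewrite (pblock_eq PN UP mU); apply: MidBlock.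
Qed.

(** Adding [last] to the block of [mid] creates no crossing: below [last],
    every point above [mid] belongs to [Q], so a crossing that uses [last] is
    already a crossing of [P] with [last] replaced by [mid]. *)
Lemma glue_nc P Q :
  P \in nc_partitions (segment a (a + i)) ->
  Q \in nc_partitions (segment (a + i) last) ->
  glue (P, Q) \in nc_partitions (segment a last.+1).
Proof.
move=> PN QN; rewrite /glue /=; set W := pblock P mid.
have WP : mid_block_spec P W by apply: mid_blockP.
have /nc_partitionsP[subP covP uniP P0 ncP] := PN.
have /nc_partitionsP[subQ covQ uniQ Q0 ncQ] := QN.
have ltP U x : U \in P -> x \in U -> a <= x < a + i.
  by move=> UP xU; have := subP _ _ UP xU; rewrite inE.
have ltQ U x : U \in Q -> x \in U -> a + i <= x < last.
  by move=> UQ xU; have := subQ _ _ UQ xU; rewrite inE.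
have ltW x : x \in W -> a <= x < a + i.
  by case: WP => [_ _ ->|_ WP _]; [rewrite inE | apply: ltP].
have PW U x : U \in P -> U <> W -> x \in U -> x \in W -> False.
  case: WP => [_ _ ->|_ WP _]; first by rewrite inE.
  by move=> UP UW xU xW; apply: UW; apply: (uniP _ _ x).
have memG U : U \in (last |: W) |: ((P :\ W) :|: Q) ->
    [\/ U = last |: W, U \in P /\ U <> W | U \in Q].
  rewrite !inE => /orP[/eqP|/orP[/andP[/eqP]|]]; first exact: Or31.
    by move=> UW UP; apply: Or32.
  exact: Or33.
have memW x : x \in last |: W -> x = last \/ x \in W.
  by rewrite !inE => /orP[/eqP|]; [left|right].
have ltlW x : x \in last |: W -> x = last :> nat \/ a <= x < a + i.
  by move=> /memW[->|/ltW]; [left | right].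
apply/nc_partitionsP; split.
- move=> U x /memG[->|[UP UW]|UQ].
  + move=> /memW[->|/ltW]; rewrite inE; arith.
  + by move=> /(ltP _ _ UP); rewrite inE; arith.
  + by move=> /(ltQ _ _ UQ); rewrite inE; arith.
- move=> x; rewrite inE => xS; have [xl|xl] := eqVneq x last.
    by exists (last |: W); rewrite !inE ?xl eqxx.
  have {xl} xl : x < last by move: xl; rewrite -val_eqE /=; arith.
  have [xi|xi] := ltnP x (a + i).
    have [|U UP xU] := covP x; first by rewrite inE; arith.
    have [UW|UW] := eqVneq U W.
      by exists (last |: W); rewrite ?inE ?eqxx // -UW xU orbT.
    by exists U; rewrite // !inE UW UP orbT.
  have [|U UQ xU] := covQ x; first by rewrite inE; arith.
  by exists U; rewrite // !inE UQ !orbT.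
- move=> U V x /memG[->|[UP UW]|UQ] /memG[->|[VP VW]|VQ] //.
  + move=> /memW[->|xW xV]; last by case: (PW V x).
    by move=> /(ltP _ _ VP); arith.
  + by move=> /ltlW + /(ltQ _ _ VQ); arith.
  + move=> xU /memW[xl|xW]; last by case: (PW U x).
    by move: xU; rewrite xl => /(ltP _ _ UP); arith.
  + exact: uniP.
  + by move=> /(ltP _ _ UP) ? /(ltQ _ _ VQ); arith.
  + by move=> /(ltQ _ _ UQ) + /ltlW; arith.
  + by move=> /(ltQ _ _ UQ) ? /(ltP _ _ VP); arith.
  + exact: uniQ.
- apply/negP => /memG[/setP/(_ last)|[]|]; rewrite ?(negPf P0) ?(negPf Q0) //.
  by rewrite !inE eqxx.
- have ncW U p q r s : U \in P -> U <> W -> p \in U -> q \in W -> r \in U ->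
      s \in last |: W -> p < q -> q < r -> r < s -> False.
    case: WP => [_ _ ->|i0 WP mW]; first by rewrite inE.
    move=> UP UW pU qW rU /memW[_|sW] pq qr rs; last exact: (ncP U W p q r s).
    apply: (ncP U W p q r mid) => //.
    have := ltP _ _ UP rU => rlt.
    suff : r != mid by rewrite -val_eqE /=; arith.
    by apply/eqP => rm; apply: (PW U r) => //; rewrite rm.
  have ncW' U p q r s : U \in P -> U <> W -> p \in last |: W -> q \in U ->
      r \in last |: W -> s \in U -> p < q -> q < r -> r < s -> False.
    move=> UP UW pW qU rW sU pq qr rs.
    have sl := ltP _ _ UP sU; case: WP => [i0 PE _|i0 WP mW].
      by move: UP; rewrite PE inE.
    have {}rW : r \in W by case: (memW _ rW) => // rl; move: rs; rewrite rl; arith.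
    have {}pW : p \in W by case: (memW _ pW) => // pl; move: pq; rewrite pl; arith.
    by apply: (ncP W U p q r s) => // WU; apply: UW.
  move=> U V p q r s /memG[->|[UP UW]|UQ] /memG[->|[VP VW]|VQ] // UV pU qV rU sV.
  + exact: (ncW' V p q r s).
  + by move: (ltQ _ _ VQ qV) (ltQ _ _ VQ sV) (ltlW _ rU); arith.
  + move=> pq qr; have [ql|qW] := memW _ qV; last exact: (ncW U p q r s).
    by move: qr (ltP _ _ UP rU); rewrite ql; arith.
  + exact: (ncP U V p q r s).
  + by move: (ltP _ _ UP pU) (ltP _ _ UP rU) (ltQ _ _ VQ qV) (ltQ _ _ VQ sV); arith.
  + by move: (ltQ _ _ UQ pU) (ltlW _ qV) (ltQ _ _ UQ rU); arith.
  + by move: (ltQ _ _ UQ pU) (ltP _ _ VP qV); arith.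
  + exact: (ncQ U V p q r s).
Qed.

Lemma pblock_glue P Q :
  P \in nc_partitions (segment a (a + i)) ->
  Q \in nc_partitions (segment (a + i) last) ->
  pblock (glue (P, Q)) last = last |: pblock P mid.
Proof.
move=> PN QN; apply: (pblock_eq (glue_nc PN QN)); by rewrite !inE eqxx.
Qed.

Lemma mid_block_lt P x : P \in nc_partitions (segment a (a + i)) ->
  x \in pblock P mid -> a <= x < a + i.
Proof.
move=> PN; have /nc_partitionsP[subP _ _ _ _] := PN.
case: (mid_blockP PN) => [_ _ ->|_ WP _ xW]; first by rewrite inE.
by have := subP _ _ WP xW; rewrite inE.
Qed.

Lemma glue_block_last P Q :
  P \in nc_partitions (segment a (a + i)) ->
  Q \in nc_partitions (segment (a + i) last) ->
  pblock (glue (P, Q)) last :\ last = pblock P mid.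
Proof.
move=> PN QN; rewrite pblock_glue // setU1K //.
by apply/negP => /(mid_block_lt PN); arith.
Qed.

Lemma gap_index_glue P Q :
  P \in nc_partitions (segment a (a + i)) ->
  Q \in nc_partitions (segment (a + i) last) ->
  gap_index (glue (P, Q)) = i.
Proof.
move=> PN QN; rewrite /gap_index glue_block_last //.
apply/eqP; rewrite eqn_leq; apply/andP; split.
  by apply/bigmax_leqP => x /(mid_block_lt PN); arith.
case: (mid_blockP PN) => [->//|i0 _ mW].
by apply: leq_trans (leq_bigmax_cond _ mW) => /=; arith.
Qed.

Lemma glueK P Q :
  P \in nc_partitions (segment a (a + i)) ->
  Q \in nc_partitions (segment (a + i) last) ->
  (lower (glue (P, Q)), upper (glue (P, Q))) = (P, Q).
Proof.
move=> PN QN; rewrite /lower glue_block_last // /upper /glue /=.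
set W := pblock P mid; have WP : mid_block_spec P W by apply: mid_blockP.
have /nc_partitionsP[subP covP uniP P0 ncP] := PN.
have /nc_partitionsP[subQ covQ uniQ Q0 ncQ] := QN.
have lowP U : U \in P -> U \subset segment a (a + i).
  by move=> UP; apply/subsetP => x; apply: subP.
have uppQ U : U \in Q -> U \subset segment (a + i) last.
  by move=> UQ; apply/subsetP => x; apply: subQ.
have nlow : (last |: W \subset segment a (a + i)) = false.
  by apply/negP => /subsetP/(_ last); rewrite !inE eqxx => /(_ isT); arith.
have nupp : (last |: W \subset segment (a + i) last) = false.
  by apply/negP => /subsetP/(_ last); rewrite !inE eqxx => /(_ isT); arith.
have lowQ U : U \in Q -> (U \subset segment a (a + i)) = false.
  move=> UQ; have /set0Pn[x xU] : U != set0 by apply: contraNneq Q0 => <-.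
  by apply/negP => /subsetP/(_ x xU); have := subQ _ _ UQ xU; rewrite !inE; arith.
have uppP U : U \in P -> (U \subset segment (a + i) last) = false.
  move=> UP; have /set0Pn[x xU] : U != set0 by apply: contraNneq P0 => <-.
  by apply/negP => /subsetP/(_ x xU); have := subP _ _ UP xU; rewrite !inE; arith.
congr (_, _); apply/setP => U; rewrite !inE.
  have [U0|U0 /=] := eqVneq U set0; first by rewrite U0 (negPf P0).
  have [UW|UW /=] := eqVneq U W.
    by case: WP => [_ _ W0|_ WP _]; rewrite UW ?WP //; move: U0; rewrite UW W0 eqxx.
  have [->|Ul /=] := eqVneq U (last |: W).
    by rewrite nlow /=; apply/esym/negP => /lowP; rewrite nlow.
  have [UP|UP /=] := boolP (U \in P); first by rewrite lowP.
  by have [UQ|] := boolP (U \in Q); [rewrite lowQ | ].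
have [->|Ul /=] := eqVneq U (last |: W).
  by rewrite nupp andbF; apply/esym/negP => /uppQ; rewrite nupp.
have [UQ|UQ] := boolP (U \in Q); first by rewrite orbT uppQ.
by rewrite orbF andbC; have [UP|] := boolP (U \in P); [rewrite uppP | rewrite !andbF].
Qed.

Section Unglue.
Variable P : {set {set 'I_N}}.
Hypothesis PN : P \in nc_partitions (segment a last.+1).
Hypothesis iP : gap_index P = i.

Let V := pblock P last.

Let VP : V \in P /\ last \in V.
Proof.
have /nc_partitionsP[_ cov _ _ _] := PN.
have [|U UP lU] := cov last; first by rewrite inE; arith.
by rewrite /V (pblock_eq PN UP lU).
Qed.

Let Vlt x : x \in V :\ last -> a <= x < a + i.
Proof.
move=> xV; have : (x - a).+1 <= gap_index P by apply: (bigmax_sup x).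
rewrite iP; have /nc_partitionsP[sub _ _ _ _] := PN.
move: xV; rewrite inE => /andP[_ xV]; have := sub _ _ VP.1 xV; rewrite inE; arith.
Qed.

Let Vmid : 0 < i -> mid \in V :\ last.
Proof.
move=> i0; have [V0|[y yV]] := set_0Vmem (V :\ last).
  by move: iP i0; rewrite /gap_index -/V V0 big_set0 => <-.
have [|x xV xmax] := @eq_bigmax_cond 'I_N (mem (V :\ last)) (fun x => (x - a).+1).
  by rewrite card_gt0; apply/set0Pn; exists y.
have {}xmax : gap_index P = (x - a).+1 by exact: xmax.
by have -> // : mid = x by apply: val_inj => /=; have := Vlt xV; arith.
Qed.

Let V0 : i = 0 -> V :\ last = set0.
Proof.
by move=> i0; apply/setP => x; rewrite [RHS]inE; apply/negP => /Vlt; arith.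
Qed.

(** A block with a point before [mid] and a point after it would cross the
    block containing [mid] and [last]. *)
Let low_or_up U : U \in P -> U <> V ->
  (U \subset segment a (a + i)) || (U \subset segment (a + i) last).
Proof.
have /nc_partitionsP[sub cov uni P0 nc] := PN.
move=> UP UV; apply: contra_notT UV; rewrite negb_or => /andP[].
move=> /subsetPn[y yU yi] /subsetPn[x xU xi].
have [xl|xl] := eqVneq x last; first by apply: (uni _ _ x) => //; rewrite ?xl; apply VP.
have [yl|yl] := eqVneq y last; first by apply: (uni _ _ y) => //; rewrite ?yl; apply VP.
have := sub _ _ UP xU; have := sub _ _ UP yU; rewrite !inE in xi yi *.
move: xl yl; rewrite -!val_eqE /= => xl yl ay ax.
have i0 : 0 < i by arith.
have [xm|xm] := eqVneq x mid.
  by apply: (uni _ _ x) => //; [case: VP | move: (Vmid i0); rewrite xm inE => /andP[]].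
move: xm; rewrite -val_eqE /= => xm.
apply/eqP; apply: contraT => /eqP UV; exfalso.
move: (Vmid i0); rewrite inE => /andP[_ mV].
apply: (nc U V x mid y last) => //; try (by case: VP); rewrite /=; arith.
Qed.

Let lowerP U : U \in lower P ->
  U = V :\ last \/ [/\ U \in P, U <> V & U \subset segment a (a + i)].
Proof.
rewrite !inE => /andP[U0 /orP[/eqP|/andP[UP Ui]]]; first by left.
right; split=> // UV; move: Ui => /subsetP/(_ last); rewrite UV inE.
by move=> /(_ VP.2); arith.
Qed.

Lemma lower_nc : lower P \in nc_partitions (segment a (a + i)).
Proof.
have /nc_partitionsP[sub cov uni P0 nc] := PN.
have [VinP lV] := VP.
have V'V x : x \in V :\ last -> x \in V by rewrite inE => /andP[].
apply/nc_partitionsP; split.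
- move=> U x /lowerP[->|[_ _ /subsetP]]; last exact.
  by move/Vlt; rewrite inE.
- move=> x; rewrite inE => xi.
  have [|U UP xU] := cov x; first by rewrite inE; arith.
  have xl : x != last by rewrite -val_eqE /=; arith.
  have [UV|UV] := eqVneq U V.
    exists (V :\ last); last by rewrite !inE xl -UV.
    rewrite !inE eqxx /= andbT; apply/set0Pn; exists x; by rewrite !inE xl -UV.
  exists U => //; rewrite !inE; apply/andP; split.
    by apply/set0Pn; exists x.
  apply/orP; right; rewrite UP /=.
  have /orP[//|/subsetP/(_ x xU)] := low_or_up UP (elimN eqP UV).
  by rewrite inE; arith.
- move=> U U' x /lowerP[->|[UP UV _]] /lowerP[->|[UP' UV' _]] //.
  + by move=> /V'V xV xU'; case: UV'; apply: (uni _ _ x).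
  + by move=> xU /V'V xV; case: UV; apply: (uni _ _ x).
  + exact: uni.
- by rewrite !inE eqxx.
- move=> U U' p q r s /lowerP[->|[UP UV _]] /lowerP[->|[UP' UV' _]] // UU'.
  + by move=> /V'V pV qU /V'V rV sU; apply: (nc V U' p q r s) => // VU; apply: UV'.
  + by move=> pV /V'V qU rV /V'V sU; apply: (nc U V p q r s).
  + exact: nc.
Qed.

Lemma upper_nc : upper P \in nc_partitions (segment (a + i) last).
Proof.
have /nc_partitionsP[sub cov uni P0 nc] := PN.
have [VinP lV] := VP.
have uP U : U \in upper P -> U \in P by rewrite inE => /andP[].
apply/nc_partitionsP; split.
- by move=> U x; rewrite inE => /andP[_ /subsetP]; apply.
- move=> x; rewrite inE => xi.
  have [|U UP xU] := cov x; first by rewrite inE; arith.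
  have UV : U <> V.
    move=> UV; suff /Vlt : x \in V :\ last by arith.
    by rewrite !inE -UV xU andbT -val_eqE /=; arith.
  exists U => //; rewrite inE UP /=; have /orP[/subsetP/(_ x xU)|//] := low_or_up UP UV.
  by rewrite inE; arith.
- by move=> U U' x /uP UP /uP UP'; apply: uni.
- by apply: contra P0; apply: uP.
- by move=> U U' p q r s /uP UP /uP UP'; apply: nc.
Qed.

Lemma unglueK : glue (lower P, upper P) = P.
Proof.
have /nc_partitionsP[sub cov uni P0 nc] := PN.
have [VinP lV] := VP.
have mb : pblock (lower P) mid = V :\ last.
  have [i0|i0] := posnP i.
    case: (mid_blockP lower_nc) => [_ _ ->|]; last by rewrite i0.
    by rewrite V0.
  apply: (pblock_eq lower_nc); last exact: Vmid.
  rewrite !inE eqxx andbT; apply/set0Pn; exists mid; exact: Vmid.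
rewrite /glue /= mb setD1K //; apply/setP => U; rewrite !inE.
have [->|UV /=] := eqVneq U V; first by rewrite VinP.
have [UP|UP /=] := boolP (U \in P); last first.
  by rewrite !orbF; have [_|_] := eqVneq U (V :\ last); rewrite /= ?andbF.
have U0 : U != set0 by apply: contraNneq P0 => <-.
have UV' : U != V :\ last.
  apply/eqP => UE; move: UV => /eqP; apply.
  have /set0Pn[x xU] := U0; apply: (uni _ _ x) => //.
  by move: xU; rewrite UE inE => /andP[].
by rewrite U0 (negPf UV') /= low_or_up //; apply/eqP.
Qed.

End Unglue.

Lemma card_gap_fibre :
  #|[set P in nc_partitions (segment a last.+1) | gap_index P == i]| =
  #|nc_partitions (segment a (a + i))| * #|nc_partitions (segment (a + i) last)|.
Proof.
rewrite -cardsX -(card_in_imset (f := glue)); last first.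
  move=> [P Q] [P' Q']; rewrite !in_setX /= => /andP[PN QN] /andP[PN' QN'] E.
  by rewrite -(glueK PN QN) E glueK.
congr #|pred_of_set _|; apply/setP => P; rewrite inE; apply/andP/imsetP.
  move=> [PN /eqP iP]; exists (lower P, upper P); last by rewrite unglueK.
  by rewrite in_setX /= lower_nc ?upper_nc.
move=> [[P1 P2]]; rewrite in_setX /= => /andP[PN QN] ->.
by rewrite glue_nc // gap_index_glue.
Qed.

End Glue.

(** The Catalan recursion on a segment: the partitions with gap index [i] are
    the gluings of a partition of the first [i] points and one of the rest. *)
Lemma card_nc_segment :
  #|nc_partitions (segment a last.+1)| =
  \sum_(i < (last - a).+1)
    #|nc_partitions (segment a (a + i))| * #|nc_partitions (segment (a + i) last)|.
Proof.
have gap_le P : P \in nc_partitions (segment a last.+1) -> gap_index P < (last - a).+1.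
  move=> PN; rewrite ltnS; apply/bigmax_leqP => x; rewrite inE => /andP[xl xV].
  have /nc_partitionsP[sub cov _ _ _] := PN.
  have [|U UP lU] := cov last; first by rewrite inE; arith.
  move: xV; rewrite (pblock_eq PN UP lU) => /(sub _ _ UP); rewrite inE.
  by move: xl; rewrite inE -val_eqE /=; arith.
rewrite -sum1_card.
rewrite (partition_big (fun P => inord (gap_index P) : 'I_(last - a).+1) predT) //=.
apply: eq_bigr => i _; rewrite -card_gap_fibre; last by have := ltn_ord i; arith.
rewrite sum1dep_card; apply: eq_card => P; rewrite !inE.
apply: andb_id2l => PN; rewrite -val_eqE /= inordK //.
by apply: gap_le; rewrite inE.
Qed.

End NonCrossingCount.

Section CatalanRecursion.
Import boot.fintype boot.finset.
Local Open Scope nat_scope.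

Lemma nc_partitions0 N : #|nc_partitions (set0 : {set 'I_N})| = 1.
Proof.
apply/eqP/cards1P; exists set0; apply/setP => P; rewrite in_set1.
apply/nc_partitionsP/eqP => [[sub _ _ P0 _]|->].
  apply/setP => U; rewrite inE; apply/negP => UP.
  have /set0Pn[x xU] : U != set0 by apply: contraNneq P0 => <-.
  by have := sub _ _ UP xU; rewrite inE.
by split=> [U x|x|U V x|/[!inE]|U V p q r s]; rewrite ?inE.
Qed.

Lemma segment0 N a : segment N a a = set0.
Proof. by apply/setP => x; rewrite !inE; arith. Qed.

(** The recursion [card_nc_segment] involves the lengths of the segments
    only; this replaces an explicit renumbering of points. *)
Lemma card_nc_segment_shift N N' a a' n :
  a + n <= N -> a' + n <= N' ->
  #|nc_partitions (segment N a (a + n))| = #|nc_partitions (segment N' a' (a' + n))|.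
Proof.
elim/ltn_ind: n N N' a a' => -[|n] IH N N' a a' aN aN'.
  by rewrite !addn0 !segment0 !nc_partitions0.
have lN : a + n < N by arith.
have lN' : a' + n < N' by arith.
rewrite !addnS (@card_nc_segment N a (Ordinal lN)) /=; last by arith.
rewrite (@card_nc_segment N' a' (Ordinal lN')) /=; last by arith.
rewrite !addKn; apply: eq_bigr => i _; have := ltn_ord i => lt_i.
congr (_ * _); first by apply: IH; arith.
have -> : a + n = a + i + (n - i) by arith.
have -> : a' + n = a' + i + (n - i) by arith.
apply: IH; arith.
Qed.

Lemma NC_segment N n : n <= N -> #|nc_partitions (segment N 0 n)| = #|NC n|.
Proof.
move=> nN; rewrite -[n in segment _ _ n]add0n (@card_nc_segment_shift _ n _ 0) //.
by congr #|pred_of_set (nc_partitions _)|; apply/setP => x; rewrite !inE ltn_ord.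
Qed.

Lemma card_NC0 : #|NC 0| = 1.
Proof. by rewrite -(@NC_segment 0) // segment0 nc_partitions0. Qed.

Lemma card_NC_catalan n : #|NC n.+1| = \sum_(i < n.+1) #|NC i| * #|NC (n - i)|.
Proof.
rewrite -(@NC_segment n.+1) // (@card_nc_segment n.+1 0 ord_max) //= subn0.
apply: eq_bigr => i _; have := ltn_ord i => lt_i.
rewrite add0n NC_segment; last by arith.
congr (_ * _); rewrite -(@NC_segment n.+1 (n - i)); last by arith.
have := @card_nc_segment_shift n.+1 n.+1 i 0 (n - i).
by rewrite subnKC // add0n; apply; arith.
Qed.

End CatalanRecursion.

Import Order.TTheory GRing.Theory Num.Theory.

Local Open Scope classical_set_scope.
Local Open Scope ring_scope.
Local Open Scope complex_scope.

(** * Formal power series *)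

(** A record rather than the function type itself: functions already carry the
    pointwise ring structure, which must not be confused with the convolution. *)
Record fps (K : Type) : Type := Fps { fps_coef :> nat -> K }.

Lemma fpsP (K : Type) (f g : fps K) : f =1 g -> f = g.
Proof. by case: f g => [f] [g] /= /funext ->. Qed.

Section FpsRing.
Variable K : comNzRingType.
Implicit Types f g h : fps K.

HB.instance Definition _ := gen_eqMixin (fps K).
HB.instance Definition _ := gen_choiceMixin (fps K).

Definition fps_zero : fps K := Fps (fun=> 0).
Definition fps_opp f : fps K := Fps (fun n => - f n).
Definition fps_add f g : fps K := Fps (fun n => f n + g n).
Definition fps_one : fps K := Fps (fun n => (n == 0)%:R).
Definition fps_mul f g : fps K := Fps (fun n => \sum_(i < n.+1) f i * g (n - i)%N).

Fact fps_addA : associative fps_add.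
Proof. by move=> f g h; apply/fpsP => n; apply: addrA. Qed.
Fact fps_addC : commutative fps_add.
Proof. by move=> f g; apply/fpsP => n; apply: addrC. Qed.
Fact fps_add0 : left_id fps_zero fps_add.
Proof. by move=> f; apply/fpsP => n; apply: add0r. Qed.
Fact fps_addN : left_inverse fps_zero fps_opp fps_add.
Proof. by move=> f; apply/fpsP => n; apply: addNr. Qed.

HB.instance Definition _ :=
  GRing.isZmodule.Build (fps K) fps_addA fps_addC fps_add0 fps_addN.

Lemma fps_mul_poly f g (p q : {poly K}) n :
  (forall i, (i <= n)%N -> p`_i = f i) -> (forall i, (i <= n)%N -> q`_i = g i) ->
  (p * q)`_n = fps_mul f g n.
Proof.
move=> pf qg; rewrite coefM; apply: eq_bigr => i _.
by rewrite pf ?qg ?leq_subr // -ltnS.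
Qed.

(* The ring axioms are inherited from polynomials: a coefficient of a product
   depends on finitely many coefficients of the factors. *)
Let trunc n f : {poly K} := \poly_(i < n.+1) f i.

Let truncE n f i : (i <= n)%N -> (trunc n f)`_i = f i.
Proof. by move=> le_in; rewrite coef_poly ltnS le_in. Qed.

Let truncM n f g i : (i <= n)%N -> (trunc n f * trunc n g)`_i = fps_mul f g i.
Proof.
by move=> le_in; apply: fps_mul_poly => j le_ji; rewrite truncE // (leq_trans le_ji).
Qed.

Fact fps_mulA : associative fps_mul.
Proof.
move=> f g h; apply/fpsP => n.
rewrite -(fps_mul_poly (p := trunc n f) (q := trunc n g * trunc n h)); first last.
- by move=> i; apply: truncM.
- by move=> i; apply: truncE.
rewrite mulrA; apply: fps_mul_poly => i; [exact: truncM | exact: truncE].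
Qed.

Fact fps_mulC : commutative fps_mul.
Proof.
move=> f g; apply/fpsP => n.
by rewrite -(@truncM n) // mulrC truncM.
Qed.

Fact fps_mul1 : left_id fps_one fps_mul.
Proof.
move=> f; apply/fpsP => n.
rewrite -(fps_mul_poly (p := 1) (q := trunc n f)) ?mul1r ?truncE //.
  by move=> i _; rewrite coef1.
by move=> i; apply: truncE.
Qed.

Fact fps_mulDl : left_distributive fps_mul fps_add.
Proof.
move=> f g h; apply/fpsP => n; rewrite /= -big_split /=.
by apply: eq_bigr => i _; rewrite mulrDl.
Qed.

Fact fps_one_neq0 : fps_one != 0 :> fps K.
Proof. by apply/eqP => /(congr1 (fun f : fps K => f 0%N))/eqP; rewrite oner_eq0. Qed.

HB.instance Definition _ := GRing.Zmodule_isComNzRing.Build (fps K)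
  fps_mulA fps_mulC fps_mul1 fps_mulDl fps_one_neq0.

Definition fpsC (c : K) : fps K := Fps (fun n => if n is 0 then c else 0).
Definition fpsX : fps K := Fps (fun n => (n == 1%N)%:R).

Lemma fpsD_coef f g n : (f + g) n = f n + g n. Proof. by []. Qed.
Lemma fpsN_coef f n : (- f) n = - f n. Proof. by []. Qed.
Lemma fpsM_coef f g n : (f * g) n = \sum_(i < n.+1) f i * g (n - i)%N.
Proof. by []. Qed.
Lemma fpsM_coef0 f g : (f * g) 0%N = f 0%N * g 0%N.
Proof. by rewrite fpsM_coef big_ord1. Qed.
Lemma fpsCM_coef c f n : (fpsC c * f) n = c * f n.
Proof.
rewrite fpsM_coef big_ord_recl /= subn0 big1 ?addr0 // => i _.
by rewrite mul0r.
Qed.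
Lemma fpsXM_coefS f n : (fpsX * f) n.+1 = f n.
Proof.
rewrite fpsM_coef big_ord_recl mul0r add0r big_ord_recl /= mul1r subSS subn0.
by rewrite big1 ?addr0 // => i _; rewrite mul0r.
Qed.
Lemma fpsXM_coef0 f : (fpsX * f) 0%N = 0.
Proof. by rewrite fpsM_coef0 mul0r. Qed.
Lemma fps_sum_coef (I : Type) (r : seq I) (F : I -> fps K) n :
  (\sum_(i <- r) F i) n = \sum_(i <- r) F i n.
Proof. exact: (big_morph (fun f : fps K => f n)). Qed.
Lemma fpsC1 : fpsC 1 = 1. Proof. by apply/fpsP; case. Qed.
Lemma fpsCM c d : fpsC (c * d) = fpsC c * fpsC d.
Proof. by apply/fpsP => -[|n]; rewrite fpsCM_coef //= mulr0. Qed.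
Lemma fpsCD c d : fpsC (c + d) = fpsC c + fpsC d.
Proof. by apply/fpsP => -[|n]; rewrite fpsD_coef //= addr0. Qed.
Lemma fpsCN c : fpsC (- c) = - fpsC c.
Proof. by apply/fpsP => -[|n]; rewrite fpsN_coef //= oppr0. Qed.

Lemma fps_regX f : fpsX * f = 0 -> f = 0.
Proof. by move=> Xf; apply/fpsP => n; rewrite -fpsXM_coefS Xf. Qed.

End FpsRing.

Section FpsDomain.
Variable K : idomainType.
Implicit Types f g h : fps K.

(** If [f] is invertible and [g] divisible by [z], the relations make [D r]
    divisible by every power of [z]. *)
Lemma fps_descent_eq0 f g (D : nat -> fps K) :
  f 0%N != 0 -> g 0%N = 0 -> (forall r, f * D r = g * D r.+1) ->
  forall r, D r = 0.
Proof.
move=> f0 g0 fD r; apply/fpsP => n; elim/ltn_ind: n r => n IH r.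
have := congr1 (fun f : fps K => f n) (fD r); rewrite !fpsM_coef [RHS]big1; last first.
  move=> [[|i] /= i_n] _; first by rewrite g0 mul0r.
  rewrite IH ?mulr0 //; move: i_n; lia.
rewrite big_ord_recl /= subn0 big1 ?addr0; last first.
  move=> i _; rewrite IH ?mulr0 // /bump add1n; move: (ltn_ord i); lia.
by move=> /eqP; rewrite mulf_eq0 (negPf f0) => /eqP.
Qed.

Lemma fps_reg f g : f 0%N != 0 -> f * g = 0 -> g = 0.
Proof.
move=> f0 fg; apply: (@fps_descent_eq0 f 0 (fun=> g) f0 _ _ 0%N) => // _.
by rewrite fg mul0r.
Qed.

End FpsDomain.

(** * Unital subalgebras *)

Section UnitalSubalgebra.
Context {R : realType} {A : algType R[i]}.
Variable S : set A.
Hypothesis subS : unital_subalgebra S.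

Lemma subalg1 : S 1.
Proof. by case: subS => + _ _; rewrite inE. Qed.
Lemma subalg_lin (c : R[i]) y z : S y -> S z -> S (c *: y + z).
Proof. by case: subS => _ + _ => /(_ c y z); rewrite !inE; apply. Qed.
Lemma subalgM y z : S y -> S z -> S (y * z).
Proof. by case: subS => _ _ /(_ y z); rewrite !inE; apply. Qed.
Lemma subalgB_scalar (c : R[i]) y : S y -> S (y - c%:A).
Proof.
by move=> Sy; rewrite addrC -scaleNr; apply: subalg_lin => //; apply: subalg1.
Qed.
Lemma subalgB y z : S y -> S z -> S (y - z).
Proof. by move=> Sy Sz; rewrite addrC -scaleN1r; apply: subalg_lin. Qed.
Lemma subalgX y n : S y -> S (y ^+ n).
Proof.
by move=> Sy; elim: n => [|n IH]; [exact: subalg1 | rewrite exprS; apply: subalgM].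
Qed.

End UnitalSubalgebra.

Section GeneratedSubalgebra.
Context {R : realType} {A : algType R[i]}.
Implicit Types (S : set A) (y z : A).

Lemma generated_unital S : unital_subalgebra (generated_subalgebra S).
Proof.
split; first by rewrite inE => B [uB _]; apply: subalg1.
  move=> c y z; rewrite !inE => Sy Sz B [uB SB].
  by apply: subalg_lin => //; [apply: Sy | apply: Sz].
move=> y z; rewrite !inE => Sy Sz B [uB SB].
by apply: subalgM => //; [apply: Sy | apply: Sz].
Qed.

Lemma generated_mem S y : S y -> generated_subalgebra S y.
Proof. by move=> Sy B [_ /(_ _ Sy)]. Qed.

Lemma generated_commute y z z' :
  generated_subalgebra [set y] z -> generated_subalgebra [set y] z' ->
  z * z' = z' * z.
Proof.
have comm_sub : forall t, unital_subalgebra [set s : A | s * t = t * s].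
  move=> t; split; first by rewrite inE /= mul1r mulr1.
    move=> c s s'; rewrite !inE /= => st s't.
    by rewrite mulrDl mulrDr -scalerAl -scalerAr st s't.
  by move=> s s'; rewrite !inE /= => st s't; rewrite -mulrA s't mulrA st mulrA.
move=> yz yz'; apply: (yz [set s | s * z' = z' * s]); split => //.
move=> _ -> /=; apply: esym.
by apply: (yz' [set s | s * y = y * s]); split => // _ ->.
Qed.

Lemma generated_compl y z :
  generated_subalgebra [set 1 - y] z -> generated_subalgebra [set y] z.
Proof.
move=> yz; apply: (yz (generated_subalgebra [set y])); split.
  exact: generated_unital.
move=> _ ->; apply: (subalgB (generated_unital _)).
  exact: (subalg1 (generated_unital _)).
exact: generated_mem.
Qed.

End GeneratedSubalgebra.

(** * Words in two free subalgebras *)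

Section Words.
Context {R : realType} {A : algType R[i]}.
Variable phi : {scalar A}.
Hypothesis phi1 : phi 1 = 1.
Variable B : bool -> set A.
Hypothesis subB : forall s, unital_subalgebra (B s).
Hypothesis freeB : free_subalgebras phi B.

Local Notation word := (seq (bool * A)).
Implicit Types (l w : word) (a y : A) (s : bool).

Definition ev w : A := \prod_(c <- w) c.2.

Lemma ev_cat w w' : ev (w ++ w') = ev w * ev w'.
Proof. exact: big_cat. Qed.
Lemma ev_cons c w : ev (c :: w) = c.2 * ev w.
Proof. exact: big_cons. Qed.
Lemma ev_nil : ev [::] = 1. Proof. exact: big_nil. Qed.

Fixpoint legal w : Prop := if w is c :: w' then B c.1 c.2 /\ legal w' else True.
Fixpoint centred w : Prop := if w is c :: w' then phi c.2 = 0 /\ centred w' else True.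

Definition alternating w := sorted (fun c d : bool * A => c.1 != d.1) w.

Lemma legal_cat w w' : legal (w ++ w') <-> legal w /\ legal w'.
Proof. by elim: w => [|c w IH] /=; [tauto | rewrite IH; tauto]. Qed.
Lemma centred_cat w w' : centred (w ++ w') <-> centred w /\ centred w'.
Proof. by elim: w => [|c w IH] /=; [tauto | rewrite IH; tauto]. Qed.
Lemma legal_nth d w j : legal w -> (j < size w)%N ->
  B (nth d w j).1 (nth d w j).2.
Proof. by elim: w j => [|c w IH] [|j] //= [Bc Bw]; [|rewrite ltnS; apply: IH]. Qed.
Lemma centred_nth d w j : centred w -> (j < size w)%N -> phi (nth d w j).2 = 0.
Proof. by elim: w j => [|c w IH] [|j] //= [Bc Bw]; [|rewrite ltnS; apply: IH]. Qed.

(** Freeness, restated for words given as lists of letters tagged by the index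
    of their subalgebra. *)
Lemma phi_alternating w :
  legal w -> centred w -> alternating w -> w != [::] -> phi (ev w) = 0.
Proof.
move=> lw cw aw w0; pose d : bool * A := (true, 0).
have -> : ev w = \prod_(j < size w) (nth d w j).2.
  by rewrite /ev (big_nth d) big_mkord.
apply: (freeB (i := fun j => (nth d w j).1)).
- by case: (w) w0.
- by move=> j; apply: legal_nth.
- by move=> j; apply: centred_nth.
move=> j j' jj'; apply/eqP.
have /(sortedP d)/(_ j) := aw; rewrite -jj'; apply; exact: ltn_ord.
Qed.

Definition centre a : A := a - (phi a)%:A.

Lemma phi_centre a : phi (centre a) = 0.
Proof. by rewrite linearB linearZ /= phi1 mulr1 subrr. Qed.

Lemma centreE a : a = phi a *: 1 + centre a.
Proof. by rewrite addrC subrK. Qed.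

Lemma sub_centre s a : B s a -> B s (centre a).
Proof. exact: subalgB_scalar. Qed.

(** The conditions under which a function of words descends to the free
    product of the two subalgebras and vanishes on its alternating centred
    products. *)
Record word_functional (F : word -> R[i]) : Prop := WordFunctional {
  wf_nil : F [::] = 0;
  wf_lin : forall w w' s (k : R[i]) a a',
    F (w ++ (s, k *: a + a') :: w') =
    k * F (w ++ (s, a) :: w') + F (w ++ (s, a') :: w');
  wf_unit : forall w w' s, F (w ++ (s, 1) :: w') = F (w ++ w');
  wf_merge : forall w w' s a a',
    F (w ++ (s, a) :: (s, a') :: w') = F (w ++ (s, a * a') :: w');
  wf_alternating : forall w, legal w -> centred w -> alternating w ->
    w != [::] -> F w = 0 }.

Lemma not_alternating w : ~~ alternating w ->
  exists w1 s a a' w2, w = w1 ++ (s, a) :: (s, a') :: w2.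
Proof.
elim: w => // -[s a] [//|[s' a'] w] IH.
rewrite /alternating /= negb_and negbK => /orP[/eqP /= <-|].
  by exists [::], s, a, a', w.
by move=> /IH[w1 [t [c [c' [w2 ->]]]]]; exists ((s, a) :: w1), t, c, c', w2.
Qed.

(** Alternating centred products and the unit span the free product.
    Concretely: replacing a letter [a] by [centre a] changes [F] by a multiple
    of its value on a shorter word, and a word that does not alternate can be
    merged into a shorter one.  Letters are centred from left to right. *)
Lemma word_functional0 F w : word_functional F -> legal w -> F w = 0.
Proof.
move=> FP; have [n] := ubnP (size w); elim: n w => // n IH w.
suff cen w1 w2 : centred w1 -> (size (w1 ++ w2) < n.+1)%N ->
    legal (w1 ++ w2) -> F (w1 ++ w2) = 0.
  by move=> wn lw; apply: (cen [::] w).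
elim: w2 w1 => [|[s a] w2 IH2] w1 c1.
  rewrite cats0 => wn lw; have [alt|] := boolP (alternating w1).
    have [->|w0] := eqVneq w1 [::]; first exact: wf_nil FP.
    exact: (wf_alternating FP).
  move=> /not_alternating[v1 [s [a [a' [v2 w1E]]]]].
  rewrite w1E (wf_merge FP); apply: IH.
    by move: wn; rewrite w1E !size_cat /= !addnS ltnS.
  move: lw; rewrite w1E !legal_cat /= => -[l1 [Ba [Ba' l2]]].
  by split=> //; split=> //; apply: subalgM.
move=> wn /legal_cat[l1 /= [Ba l2]].
rewrite (centreE a) (wf_lin FP) (wf_unit FP) IH ?mulr0 ?add0r.
- rewrite -cat_rcons; apply: IH2.
  + by rewrite -cats1; apply/centred_cat; split=> //=; split=> //; apply: phi_centre.
  + by rewrite cat_rcons; move: wn; rewrite !size_cat.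
  + rewrite cat_rcons; apply/legal_cat; split=> //=; split=> //; exact: sub_centre.
- by move: wn; rewrite !size_cat /= addnS ltnS.
- exact/legal_cat.
Qed.

Hypothesis commB : forall s a a', B s a -> B s a' -> a * a' = a' * a.

(** At the end where [a] is multiplied, either [a] starts a new alternation, or
    it merges with the last letter; in both cases the result is a combination
    of alternating centred products.  The length bound excludes the one-letter
    word, which could cancel against [a]. *)
Lemma phi_centred_word_mul w s a : B s a ->
  legal w -> centred w -> alternating w -> (1 < size w)%N ->
  phi (ev w * a) = 0 /\ phi (a * ev w) = 0.
Proof.
move=> Ba lw cw aw w2.
have Ba0 := sub_centre Ba.
have wN : w != [::] by case: (w) w2.
have phiw := phi_alternating lw cw aw wN; split.
  move: w2 wN phiw; case/lastP: w lw cw aw => // w [t c].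
  rewrite /alternating -cats1 => /legal_cat[lw [/= Bc _]].
  move=> /centred_cat[cw [/= c0 _]] aw w2 _ phiw.
  have aw' := cat_sorted2 aw; case: aw' => aw' _.
  have {}w2 : w != [::] by case: (w) w2.
  have [ts|ts] := eqVneq t s.
    subst t; have -> : ev (w ++ [:: (s, c)]) * a =
        phi (c * a) *: ev w + ev (w ++ [:: (s, centre (c * a))]).
      rewrite !ev_cat !ev_cons ev_nil /= !mulr1 -mulrA {1}(centreE (c * a)).
      by rewrite mulrDr -scalerAr mulr1.
    rewrite linearP /= (phi_alternating lw) // mulr0 add0r.
    apply: phi_alternating; last by case: (w).
    - by apply/legal_cat; split=> //=; split=> //; apply: sub_centre; apply: subalgM.
    - by apply/centred_cat; split=> //=; split=> //; apply: phi_centre.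
    - by move: aw; rewrite /alternating; case: (w) => // d v; rewrite /= !cat_path.
  rewrite {1}(centreE a) mulrDr -scalerAr mulr1 linearP /= phiw mulr0 add0r.
  have -> : ev (w ++ [:: (t, c)]) * centre a =
      ev ((w ++ [:: (t, c)]) ++ [:: (s, centre a)]).
    by rewrite [RHS]ev_cat ev_cons ev_nil mulr1.
  apply: phi_alternating; last by case: (w).
  - by apply/legal_cat; split=> //; apply/legal_cat.
  - apply/centred_cat; split; first exact/centred_cat.
    by split=> //; apply: phi_centre.
  - move: aw; rewrite /alternating; case: (w) => [|d v] /=; first by rewrite ts.
    by rewrite !cat_path /= last_cat /= ts => /andP[-> /andP[->]].
move: w2 wN phiw; case: w lw cw aw => // -[t c] [//|d w] /= [Bc lw] [c0 cw].
move=> /andP[/= tw aw] _ _ phiw.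
have [ts|ts] := eqVneq t s.
  subst t; have -> : a * ev ((s, c) :: d :: w) =
      phi (a * c) *: ev (d :: w) + ev ((s, centre (a * c)) :: d :: w).
    rewrite ![ev (_ :: d :: _)]ev_cons /= mulrA {1}(centreE (a * c)).
    by rewrite mulrDl -scalerAl mul1r.
  rewrite linearP /= (phi_alternating (w := d :: w)) // mulr0 add0r.
  apply: phi_alternating => //=.
  - by split=> //; apply: sub_centre; apply: subalgM.
  - by split=> //; apply: phi_centre.
  - by rewrite /alternating /= tw.
rewrite {1}(centreE a) mulrDl -scalerAl mul1r linearP /= phiw mulr0 add0r.
rewrite -(ev_cons (s, centre a)); apply: phi_alternating => //=.
- by split=> //; apply: phi_centre.
- by rewrite /alternating /= eq_sym ts tw.
Qed.

(** The free product of two tracial functionals is tracial; here both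
    subalgebras are commutative, so [phi] is a trace on each of them. *)
Lemma phi_trace_letter w s a : B s a -> legal w -> phi (ev w * a) = phi (a * ev w).
Proof.
move=> Ba lw; apply/eqP; rewrite -subr_eq0; apply/eqP.
apply: (word_functional0 (F := fun w => phi (ev w * a) - phi (a * ev w))) lw.
split=> [|v v' t k c c'|v v' t|v v' t c c'|v lv cv av v0].
- by rewrite ev_nil mul1r mulr1 subrr.
- rewrite !ev_cat !ev_cons /= !(mulrDl, mulrDr) -!(scalerAl, scalerAr) !linearP /=.
  by rewrite -[k *: _]/(k * _); ring.
- by rewrite !ev_cat !ev_cons /= mul1r.
- by rewrite !ev_cat !ev_cons /= !mulrA.
have [v2|] := ltnP 1 (size v).
  by have [-> ->] := phi_centred_word_mul Ba lv cv av v2; rewrite subrr.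
case: v lv cv av v0 => // -[t c] [|//] /= [Bc _] [c0 _] _ _ _.
rewrite ev_cons ev_nil /= mulr1; have [ts|ts] := eqVneq t s.
  by subst t; rewrite (commB Bc Ba) subrr.
rewrite (centreE a) mulrDr mulrDl -scalerAr -scalerAl mulr1 mul1r !linearP /= c0.
have Ba0 := sub_centre Ba.
have a0 := phi_centre a.
have -> : phi (c * centre a) = 0.
  have := @phi_alternating [:: (t, c); (s, centre a)].
  by rewrite !ev_cons ev_nil /alternating /= mulr1 ts; apply.
have -> : phi (centre a * c) = 0; last by rewrite !(oppr0, scaler0, mulr0, addr0).
have := @phi_alternating [:: (s, centre a); (t, c)].
by rewrite !ev_cons ev_nil /alternating /= mulr1 eq_sym ts; apply.
Qed.

(** The value of [phi ⊗ phi] on [y (delta w) z], where [delta] is the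
    derivation that kills the letters of index [true] and sends a letter [a]
    of index [false] to [a ⊗ 1 - 1 ⊗ a]. *)
Fixpoint liberation_sum (y : A) w (z : A) : R[i] :=
  if w is (s, a) :: w' then
    (if s then 0 else
       phi (y * a) * phi (ev w' * z) - phi y * phi (a * (ev w' * z)))
    + liberation_sum (y * a) w' z
  else 0.

Lemma liberation_sum_cat y w w' z :
  liberation_sum y (w ++ w') z =
  liberation_sum y w (ev w' * z) + liberation_sum (y * ev w) w' z.
Proof.
elim: w y => [|[s a] w IH] y /=; first by rewrite ev_nil mulr1 add0r.
by rewrite IH ev_cons ev_cat /= !mulrA addrA.
Qed.

Lemma liberation_sum_linl y y' k w z :
  liberation_sum (k *: y + y') w z = k * liberation_sum y w z + liberation_sum y' w z.
Proof.
elim: w y y' => [|[s a] w IH] y y' /=; first by rewrite mulr0 addr0.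
rewrite mulrDl -scalerAl IH !linearP /=; case: s; ring.
Qed.

Lemma liberation_sum_linr y k w z z' :
  liberation_sum y w (k *: z + z') = k * liberation_sum y w z + liberation_sum y w z'.
Proof.
elim: w y => [|[s a] w IH] y /=; first by rewrite mulr0 addr0.
by rewrite !mulrDr -!scalerAr IH !linearP /=; case: s; ring.
Qed.

(** Each term is a product of two factors, one of which is [phi] of a nonempty
    alternating product of centred letters: the prefix ending with the current
    letter, or the suffix starting with it. *)
Lemma liberation_sum_alternating w1 w2 :
  legal (w1 ++ w2) -> centred (w1 ++ w2) -> alternating (w1 ++ w2) ->
  liberation_sum (ev w1) w2 1 = 0.
Proof.
elim: w2 w1 => [|[s a] w2 IH] w1 //= lw cw aw.
have evE : ev w1 * a = ev (rcons w1 (s, a)).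
  by rewrite -cats1 ev_cat ev_cons ev_nil mulr1.
rewrite evE IH ?cat_rcons // addr0 mulr1 -(ev_cons (s, a)).
have /legal_cat[_ lw2] := lw; have /centred_cat[_ cw2] := cw.
have [_ aw2] := cat_sorted2 aw.
rewrite (phi_alternating lw2) // mulr0 subr0 -evE.
move: lw cw aw; rewrite -cat_rcons => /legal_cat[lw _] /centred_cat[cw _].
move=> /cat_sorted2[aw _]; rewrite evE (phi_alternating lw) ?mul0r ?if_same //.
by case: (w1).
Qed.

(** Voiculescu's liberation identity.  The relation [delta (a a') =
    delta (a) a' + a delta (a')] holds on the letters of index [false], which
    gives the compatibility with merging. *)
Lemma liberation w : legal w -> liberation_sum 1 w 1 = 0.
Proof.
apply: (word_functional0 (F := fun w => liberation_sum 1 w 1)); split => //.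
- move=> v v' s k a a'; rewrite !liberation_sum_cat /= !ev_cons /= !mulr1 !mul1r.
  rewrite mulrDl mulrDr -scalerAl -scalerAr liberation_sum_linr liberation_sum_linl.
  by rewrite !linearP /=; case: s; ring.
- move=> v v' s; rewrite !liberation_sum_cat /= !ev_cons /= !mulr1 !mul1r.
  by case: s; ring.
- move=> v v' s a a'; rewrite !liberation_sum_cat /= !ev_cons /= !mulr1 !mul1r !mulrA.
  by case: s; ring.
move=> v lv cv av _; by have := @liberation_sum_alternating [::] v lv cv av; rewrite ev_nil.
Qed.

End Words.

(** * Moment series of a free pair *)

Section FreePair.
Context {R : realType} {A : algType R[i]}.
Variable phi : {scalar A}.
Hypothesis phi1 : phi 1 = 1.
Variables x b : A.
Hypothesis free_xb : free_pair phi x b.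

Let B (s : bool) : set A := generated_subalgebra [set if s then x else b].

Let subB s : unital_subalgebra (B s). Proof. exact: generated_unital. Qed.
Let commB s a a' : B s a -> B s a' -> a * a' = a' * a.
Proof. exact: generated_commute. Qed.
Let Bx r : B true (x ^+ r).
Proof. by apply: (subalgX (subB _)); apply: generated_mem. Qed.
Let Bb r : B false (b ^+ r).
Proof. by apply: (subalgX (subB _)); apply: generated_mem. Qed.

Definition powers_word n : seq (bool * A) :=
  flatten (nseq n [:: (true, x); (false, b)]).

Lemma ev_powers_word n : ev (powers_word n) = (x * b) ^+ n.
Proof.
elim: n => [|n IH]; first by rewrite expr0 ev_nil.
by rewrite exprS /= !ev_cons IH /= mulrA.
Qed.

Let legal_powers n : legal B (powers_word n).
Proof.
by elim: n => //= n ?; split; [exact: (Bx 1) | split; [exact: (Bb 1) |]].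
Qed.

Lemma liberation_sum_powers_word y n : liberation_sum phi y (powers_word n) 1 =
  \sum_(i < n) (phi (y * (x * b) ^+ i.+1) * phi ((x * b) ^+ (n.-1 - i)) -
               phi (y * (x * b) ^+ i * x) * phi (b * (x * b) ^+ (n.-1 - i))).
Proof.
elim: n y => [|n IH] y; first by rewrite big_ord0.
rewrite big_ord_recl /= add0r IH ev_powers_word subn0 !mulr1 expr1 mulrA.
congr (_ + _); apply: eq_bigr => i _; rewrite /bump /= add1n.
have -> : (n - i.+1 = n.-1 - i)%N by case: n {IH} i.
by rewrite -!(mulrA y x b) -!(mulrA y (x * b)) -!exprS.
Qed.

Local Notation K := (R[i] : comNzRingType).
(** [phi (y U)] and [phi (y U x)], where [U = sum_n z^n (x b)^n]. *)
Definition moment_series (y : A) : fps K := Fps (fun n => phi (y * (x * b) ^+ n)).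
Definition moment_series_x (y : A) : fps K := Fps (fun n => phi (y * (x * b) ^+ n * x)).

(** In terms of series, [delta U = U z x b ⊗ U - z U x ⊗ b U]; the constant
    term of [phi (y U)] is subtracted because [U z x b = U - 1]. *)
Lemma liberation_sum_series y :
  Fps (fun n => liberation_sum phi y (powers_word n) 1) =
  (moment_series y - fpsC (phi y)) * moment_series 1 -
    fpsX _ * (moment_series_x y * moment_series b).
Proof.
apply/fpsP => -[|n].
  rewrite fpsD_coef fpsN_coef fpsXM_coef0 fpsM_coef0 fpsD_coef fpsN_coef.
  by rewrite /= expr0 mulr1 subrr mul0r subrr.
rewrite -[LHS]/(liberation_sum phi y (powers_word n.+1) 1) liberation_sum_powers_word.
rewrite fpsD_coef fpsN_coef fpsXM_coefS 2!fpsM_coef.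
rewrite [X in _ = X - _]big_ord_recl fpsD_coef fpsN_coef [moment_series y ord0]/= expr0 mulr1
  [fpsC _ ord0]/= subrr mul0r add0r.
rewrite -sumrB; apply: eq_bigr => i _; rewrite fpsD_coef fpsN_coef subr0.
by rewrite lift0 subSS /= mul1r.
Qed.

Lemma moment_series_x_powx r : moment_series_x (x ^+ r) = moment_series (x ^+ r.+1).
Proof.
apply/fpsP => n; rewrite /= -ev_powers_word -(ev_cons (true, x ^+ r)).
rewrite (@phi_trace_letter _ _ phi phi1 B subB free_xb commB _ true) ?ev_cons /=.
- by rewrite mulrA -exprS.
- exact: (Bx 1).
- by split.
Qed.

Lemma moment_series_powx r :
  (moment_series (x ^+ r) - fpsC (phi (x ^+ r))) * moment_series 1 =
  fpsX _ * moment_series b * moment_series (x ^+ r.+1).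
Proof.
apply/eqP; rewrite -moment_series_x_powx -mulrA [moment_series b * _]mulrC.
rewrite -subr_eq0 -liberation_sum_series.
apply/eqP/fpsP => n.
have := @liberation _ _ phi phi1 B subB free_xb ((true, x ^+ r) :: powers_word n).
by rewrite /= add0r mul1r; apply; split.
Qed.

(** The liberation identity for [b^(r+1) U] has the extra term coming from
    [delta (b^(r+1))], which turns [M] into [M - 1]; traciality rewrites
    [z phi (b^(r+1) U x)] as [phi (b^r U z x b) = phi (b^r U) - phi (b^r)]. *)
Lemma moment_series_powb r :
  (moment_series 1 - 1) * moment_series (b ^+ r.+1) =
  (moment_series (b ^+ r) - fpsC (phi (b ^+ r))) * moment_series b.
Proof.
have tr : fpsX _ * moment_series_x (b ^+ r.+1) =
    moment_series (b ^+ r) - fpsC (phi (b ^+ r)).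
  apply/fpsP => -[|n]; rewrite fpsD_coef fpsN_coef.
    by rewrite fpsXM_coef0 /= expr0 mulr1 subrr.
  rewrite fpsXM_coefS subr0 /= [in RHS]exprSr !mulrA.
  have -> : b ^+ r * (x * b) ^+ n * x * b =
      ev ((false, b ^+ r) :: powers_word n ++ [:: (true, x)]) * b.
    by rewrite ev_cons ev_cat ev_powers_word ev_cons ev_nil /= mulr1 !mulrA.
  rewrite (@phi_trace_letter _ _ phi phi1 B subB free_xb commB _ false) ?ev_cons /=.
  - by rewrite ev_cat ev_powers_word ev_cons ev_nil /= mulr1 !mulrA -exprS.
  - exact: (Bb 1).
  - by split=> //; apply/legal_cat; split=> //=; split=> //; apply: (Bx 1).
have := liberation_sum_series (b ^+ r.+1); rewrite mulrA tr.
set y := b ^+ r.+1.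
have -> : Fps (fun n => liberation_sum phi y (powers_word n) 1) =
    moment_series y - fpsC (phi y) * moment_series 1.
  apply/fpsP => n.
  rewrite fpsD_coef fpsN_coef fpsCM_coef /= mul1r.
  have := @liberation _ _ phi phi1 B subB free_xb ((false, y) :: powers_word n).
  rewrite /= mul1r phi1 mul1r mulr1 ev_powers_word => L0.
  by rewrite -[LHS]subr0 -(L0 (conj (Bb _) (legal_powers _))); ring.
move/eqP; rewrite -subr_eq0 => /eqP E.
by apply/esym/eqP; rewrite -subr_eq0; apply/eqP; apply: etrans E; ring.
Qed.

End FreePair.

(** * The system satisfied by the moment series *)

Section SeriesSystem.
Variable K : idomainType.
Variables (N L : nat -> fps K) (m be : nat -> K).
Hypothesis N_coef0 : forall r, N r 0%N = m r.
Hypothesis L_coef0 : forall r, L r 0%N = be r.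
Hypotheses (m0 : m 0%N = 1).

Local Notation C := (@fpsC K).
Local Notation X := (@fpsX K).
Local Notation M := (N 0%N).
Local Notation H := (L 1%N).

Hypothesis N_rec : forall r, (N r - C (m r)) * M = X * H * N r.+1.
Hypothesis L_rec : forall r, (M - 1) * L r.+1 = (L r - C (be r)) * H.

(** The recursion of the moments of a free Poisson variable of rate one and
    jump size [al]. *)
Definition catalan_type (al : K) :=
  forall r, m r.+1 = al * \sum_(i < r.+1) m i * m (r - i)%N.

(** With [s = z H / M], the recursion [N_rec] says that [N (r+1)] is the
    quotient of [N r - m r] by [s], so [N r] is the [r]-fold shift of the
    series [sum_k m k s^k]. By the Leibniz rule [T (f g) = T f g + f(0) T g]
    of the shift [T], the series [conv_tail r] is the [r]-fold shift of its
    square [N 0 ^+ 2]. *)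
Definition conv_tail r : fps K :=
  N 0%N * N r + \sum_(i < r) C (m i) * N (r - i)%N.

Lemma conv_tail_coef0 r : conv_tail r 0%N = \sum_(i < r.+1) m i * m (r - i)%N.
Proof.
rewrite fpsD_coef fpsM_coef0 fps_sum_coef !N_coef0 addrC.
rewrite [RHS]big_ord_recr subnn [m ord_max * _]mulrC; congr (_ + _).
by apply: eq_bigr => i _; rewrite fpsCM_coef N_coef0.
Qed.

Lemma conv_tail_rec r :
  X * H * conv_tail r.+1 = M * (conv_tail r - C (conv_tail r 0%N)).
Proof.
have -> : conv_tail r.+1 = N 0%N * N r.+1 + C (m r) * N 1%N +
    \sum_(i < r) C (m i) * N (r - i).+1.
  rewrite /conv_tail big_ord_recr /= subSnn -!addrA; congr (_ + _).
  rewrite addrC; congr (_ + _).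
  by apply: eq_bigr => i _; rewrite subSn // ltnW.
have -> : C (conv_tail r 0%N) =
    C (m 0%N) * C (m r) + \sum_(i < r) C (m i) * C (m (r - i)%N).
  rewrite conv_tail_coef0 big_ord_recr /= subnn addrC fpsCD fpsCM mulrC.
  congr (_ + _); apply: fpsP => -[|n].
    by rewrite fps_sum_coef; apply: eq_bigr => i _; rewrite fpsCM_coef.
  by rewrite fps_sum_coef [RHS]big1 // => i _; rewrite fpsCM_coef /= mulr0.
rewrite /conv_tail; set S := \sum_(i < r) C (m i) * N (r - i).+1.
set S1 := \sum_(i < r) _; set S2 := \sum_(i < r) _.
have ES : X * H * S = (S1 - S2) * M.
  rewrite /S1 /S2 -sumrB mulr_sumr mulr_suml; apply: eq_bigr => i _.
  by rewrite mulrCA -N_rec -mulrBr mulrA.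
rewrite !mulrDr ES [X * H * (_ * N r.+1)]mulrCA -N_rec.
rewrite [X * H * (_ * N 1%N)]mulrCA -N_rec; ring.
Qed.

(** The deviation [N (r+1) - al conv_tail r] of the moments from the Catalan
    recursion is shifted in the same way; its constant term is the defect of
    that recursion at [r]. *)
Lemma deviation_rec al r :
  X * H * (N r.+2 - C al * conv_tail r.+1) =
  M * (N r.+1 - C al * conv_tail r -
       C ((N r.+1 - C al * conv_tail r) 0%N)).
Proof.
rewrite mulrBr -N_rec [X * H * (C al * _)]mulrCA conv_tail_rec.
by rewrite fpsD_coef fpsN_coef fpsCM_coef N_coef0 fpsCD fpsCN fpsCM; ring.
Qed.

Let M_coef0 : M 0%N != 0. Proof. by rewrite N_coef0 m0 oner_neq0. Qed.

(** The deviation vanishes for [r = 0], hence so do all its shifts, in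
    particular their constant terms. *)
Lemma catalan_of_series al :
  be 1%N != 0 -> N 1%N = C al * M ^+ 2 -> catalan_type al.
Proof.
move=> be0 N1 r.
suff /(congr1 (fun f : fps K => f 0%N)) : N r.+1 - C al * conv_tail r = 0.
  rewrite fpsD_coef fpsN_coef fpsCM_coef N_coef0 conv_tail_coef0.
  by move/eqP; rewrite subr_eq0 => /eqP.
elim: r => [|r IH].
  by rewrite /conv_tail big_ord0 addr0 -expr2 N1 subrr.
have := deviation_rec al r; rewrite IH sub0r -fpsCN oppr0.
have -> : C 0 = 0 by apply/fpsP => -[].
rewrite mulr0 -mulrA => /fps_regX/fps_reg; apply.
by rewrite L_coef0.
Qed.

(** Here all the constant terms vanish, so the deviation is divisible by every
    power of [s]. *)
Lemma series_of_catalan al : catalan_type al -> N 1%N = C al * M ^+ 2.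
Proof.
move=> cat; apply/eqP; rewrite -subr_eq0; apply/eqP.
have := @fps_descent_eq0 K M (X * H) (fun r => N r.+1 - C al * conv_tail r)
  M_coef0 _ _ 0%N.
rewrite /conv_tail big_ord0 addr0 -expr2; apply.
  by rewrite fpsXM_coef0.
move=> r; rewrite deviation_rec fpsD_coef fpsN_coef fpsCM_coef N_coef0.
rewrite conv_tail_coef0 -cat subrr.
have -> : C 0 = 0 by apply/fpsP => -[].
by rewrite subr0.
Qed.

Variable al : K.
Hypothesis split_rel : X * N 1%N = M - 1 + X * C (al * (1 - be 1%N)) * M.

(** The second recursion, applied to the differences [L (r+1) - L (r+2)],
    shows that [L 2 = L 1]; the value of [H] so obtained closes the system. *)
Lemma catalan_of_constant_moments :
  be 1%N != 0 -> be 1%N != 1 -> (forall r, be r.+1 = be 1%N) -> catalan_type al.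
Proof.
move=> be0 be1 beE; set p := be 1%N in be0 be1 beE.
have M1 : (M - 1) 0%N = 0 by rewrite fpsD_coef N_coef0 m0 subrr.
have H0 : H 0%N != 0 by rewrite L_coef0.
have L12 : L 1%N - L 2%N = 0.
  apply: (@fps_descent_eq0 K H (M - 1) (fun r => L r.+1 - L r.+2) H0 M1 _ 0%N) => r.
  by rewrite [RHS]mulrBr !L_rec !beE; ring.
have HM : M - 1 - (H - C p) = 0.
  apply: (fps_reg H0); rewrite mulrBr [H * (M - 1)]mulrC [H * (H - _)]mulrC.
  by rewrite /p -L_rec -mulrBr L12 mulr0.
have {}HM : H = M - 1 + C p.
  by apply/eqP; rewrite -subr_eq0 -oppr_eq0; apply/eqP; rewrite -[RHS]HM; ring.
have N1 : (M - 1) * M = X * H * N 1%N by rewrite -N_rec m0 fpsC1.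
have Mal : M - 1 - C al * X * M * H = 0.
  apply: (@fps_reg K (C (1 - p))); first by rewrite /= subr_eq0 eq_sym.
  have <- : (M - 1) * M - H * (M - 1 + X * C (al * (1 - p)) * M) = 0.
    by rewrite -split_rel N1; ring.
  by rewrite fpsCM HM !(fpsCD, fpsCN) fpsC1; ring.
apply: catalan_of_series => //; apply/eqP; rewrite -subr_eq0; apply/eqP.
apply: (fps_reg H0); apply: fps_regX.
rewrite mulrA mulrBr -N1; apply: etrans (mulr0 M).
by rewrite -Mal; ring.
Qed.

(** The Catalan recursion gives [M - 1 = al z M H], and with the split relation
    [M - 1 = H - p].  The former makes [M - 1] regular, which allows the
    induction [L (r+1) = H]. *)
Lemma constant_moments_of_catalan :
  al != 0 -> be 1%N != 0 -> catalan_type al -> forall r, be r.+1 = be 1%N.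
Proof.
move=> al0 be0 /series_of_catalan N1; set p := be 1%N in be0 *.
have H0 : H 0%N != 0 by rewrite L_coef0.
have Mal : M - 1 - C al * X * M * H = 0.
  apply: (fps_reg M_coef0).
  have : (M - 1) * M = X * H * N 1%N by rewrite -N_rec m0 fpsC1.
  by rewrite N1 => E; rewrite mulrBr [M * (M - 1)]mulrC E; ring.
have HM : M - 1 - (H - C p) = 0.
  apply: (fps_reg M_coef0); apply: (@fps_reg K (C al)) => //; apply: fps_regX.
  have E : X * (C al * M ^+ 2) - (M - 1 + X * C (al * (1 - p)) * M) = 0.
    by rewrite -N1 split_rel subrr.
  apply: etrans (etrans (congr2 +%R E Mal) (addr0 0)).
  by rewrite fpsCM !(fpsCD, fpsCN) fpsC1; ring.
have cancel f : (M - 1) * f = 0 -> f = 0.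
  have -> : M - 1 = X * (C al * (M * H)).
    by apply/eqP; rewrite -subr_eq0; apply/eqP; apply: etrans Mal; ring.
  rewrite -!mulrA => /fps_regX /(@fps_reg K (C al) _ al0).
  by move=> /(fps_reg M_coef0) /(fps_reg H0).
have LH r : L r.+1 = H.
  elim: r => // r IH; apply/eqP; rewrite -subr_eq0; apply/eqP/cancel.
  rewrite mulrBr L_rec IH.
  have -> : be r.+1 = p by rewrite -L_coef0 IH L_coef0.
  by apply: etrans (mulr0 (- H)); rewrite -HM; ring.
by move=> r; rewrite -L_coef0 LH L_coef0.
Qed.

End SeriesSystem.

(** * Free Poisson variables of rate one *)

Section GeometricCumulants.
Context {R : realType} {A : algType R[i]}.
Variable phi : A -> R[i].
Hypothesis phi1 : phi 1 = 1.
Variables (x : A) (al : R[i]).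

(** With cumulants [al^n], all the terms of the moment-cumulant formula are
    equal, since the blocks of a partition have total size [n]. *)
Lemma prod_blocks n (P : {set {set 'I_n}}) :
  P \in NC n -> \prod_(V in P) al ^+ #|V| = al ^+ n.
Proof.
rewrite inE => /andP[PT _]; rewrite -[in RHS](card_ord n) -cardsT.
rewrite (finset.card_partition PT).
by rewrite (big_morph (fun k => al ^+ k) (exprD al) (expr0 al)).
Qed.

Definition geometric_cumulants := forall n, (0 < n)%N ->
  free_cumulant phi (fun _ : 'I_n => x) = al ^+ n.

Lemma moments_of_geometric_cumulants :
  geometric_cumulants -> forall n, phi (x ^+ n) = al ^+ n * #|NC n|%:R.
Proof.
move=> geo [|n]; first by rewrite card_NC0 expr0 phi1 mulr1.
have := moment_cumulant phi (fun _ : 'I_n.+1 => x) (ltn0Sn n).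
rewrite prodr_const card_ord => ->.
rewrite mulr_natr -sumr_const; apply: eq_bigr => P PN.
rewrite -(prod_blocks PN); apply: eq_bigr => V VP; apply: geo.
move: PN; rewrite inE => /andP[/and3P[_ _ P0] _].
by rewrite card_gt0; apply: contraNneq P0 => <-.
Qed.

Lemma geometric_cumulants_of_moments :
  (forall n, phi (x ^+ n) = al ^+ n * #|NC n|%:R) -> geometric_cumulants.
Proof.
move=> mom; elim/ltn_ind => n IH n0.
have := moment_cumulant phi (fun _ : 'I_n => x) n0.
rewrite prodr_const card_ord mom mulr_natr -sumr_const.
rewrite (bigD1 [set [set: 'I_n]]%SET) ?NC_one_block //=.
rewrite [RHS](bigD1 [set [set: 'I_n]]%SET) ?NC_one_block //=.
rewrite finset.big_set1 (restrict_blockT (free_cumulant phi)).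
set S := (X in _ + X = _); set T := (X in _ = _ + X).
suff -> : S = T by move/addIr.
apply: eq_bigr => P /andP[PN PT]; rewrite -(prod_blocks PN).
by apply: eq_bigr => V VP; have /andP[V0 Vn] := NC_block PN PT VP; rewrite -IH.
Qed.

Lemma geometric_cumulantsP :
  geometric_cumulants <-> catalan_type (fun n => phi (x ^+ n)) al.
Proof.
split=> [/moments_of_geometric_cumulants mom r | cat].
  rewrite mom card_NC_catalan natr_sum mulr_sumr exprS mulr_sumr.
  apply: eq_bigr => i _; rewrite !mom natrM.
  have -> : al ^+ r = al ^+ i * al ^+ (r - i)%N.
    by rewrite -exprD subnKC // -ltnS.
  ring.
apply: geometric_cumulants_of_moments; elim/ltn_ind => -[_|n IH].
  by rewrite card_NC0 expr0 phi1 mulr1.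
rewrite cat card_NC_catalan natr_sum !mulr_sumr exprS.
apply: eq_bigr => i _; have := ltn_ord i => lt_in.
rewrite !IH ?natrM; [|lia|lia].
have -> : al ^+ n = al ^+ i * al ^+ (n - i)%N.
  by rewrite -exprD subnKC // -ltnS.
ring.
Qed.

End GeometricCumulants.

(** * Free splittings of a variable *)

Section Splitting.
Context {R : realType} {A : algType R[i]}.
Variable phi : {scalar A}.
Hypothesis phi1 : phi 1 = 1.

Lemma free_pair_mul (y z y' z' : A) : free_pair phi y z ->
  generated_subalgebra [set y] y' -> generated_subalgebra [set z] z' ->
  phi (y' * z') = phi y' * phi z'.
Proof.
move=> free yy zz; pose B (s : bool) := generated_subalgebra [set if s then y else z].
have subB s : unital_subalgebra (B s) by apply: generated_unital.
have yy0 : B true (centre phi y') by apply: (@sub_centre _ _ phi B subB true).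
have zz0 : B false (centre phi z') by apply: (@sub_centre _ _ phi B subB false).
have := phi_alternating free (w := [:: (true, centre phi y'); (false, centre phi z')]).
rewrite !ev_cons ev_nil mulr1 /= => yz0.
rewrite {1}(centreE phi y') mulrDl -scalerAl mul1r linearP /=.
rewrite {2}(centreE phi z') mulrDr -scalerAr mulr1 linearP /= phi_centre //.
by rewrite yz0 ?mulr0 ?addr0 //; split; rewrite ?phi_centre.
Qed.

Lemma free_pair_compl (y z : A) : free_pair phi y z -> free_pair phi y (1 - z).
Proof.
move=> free k i a k0 ia; apply: free => // j.
by have := ia j; case: (i j) => //; apply: generated_compl.
Qed.

Lemma free_pairC (y z : A) : free_pair phi y z -> free_pair phi z y.
Proof.
move=> free k i a k0 ia a0 alt; apply: (free k (fun j => ~~ i j)) => // j.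
  by have := ia j; case: (i j).
by move=> j' jj' /(congr1 negb); rewrite !negbK; apply: alt.
Qed.

Variables x b : A.
Hypothesis free_xb : free_pair phi x b.
Hypothesis free_split : free_pair phi (x * b) (x * (1 - b)).

Local Notation mom := (moment_series phi x b).

Lemma mom_coef0 y : mom y 0%N = phi y.
Proof. by rewrite /= expr0 mulr1. Qed.

(** [phi (u^n v) = phi (u^n) phi v], with [u^n v = u^n x - u^(n+1)]. *)
Lemma split_series :
  fpsX _ * mom (x ^+ 1) =
  mom 1 - 1 + fpsX _ * fpsC (phi x * (1 - phi b)) * mom 1.
Proof.
rewrite -(moment_series_x_powx phi1 free_xb 0) -mulrA.
apply/fpsP => -[|n]; rewrite !fpsD_coef fpsN_coef.
  by rewrite !fpsXM_coef0 mom_coef0 phi1 /= subrr addr0.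
rewrite !fpsXM_coefS fpsCM_coef subr0 /= expr0 !mul1r.
have <- : phi (x * (1 - b)) = phi x * (1 - phi b).
  rewrite (@free_pair_mul x b) //; last first.
  - apply: (subalgB (generated_unital _)); last exact: generated_mem.
    exact: (subalg1 (generated_unital _)).
  - exact: generated_mem.
  by rewrite linearB phi1.
have := @free_pair_mul _ _ ((x * b) ^+ n) (x * (1 - b)) free_split.
rewrite mulrC => <-; last exact: generated_mem.
  by rewrite mulrA mulrBr mulr1 linearB /= -mulrA -exprSr; ring.
by apply: (subalgX (generated_unital _)); apply: generated_mem.
Qed.

Lemma catalan_of_bernoulli (p : R) : 0 < p < 1 -> bernoulli_variable phi b p ->
  catalan_type (fun n => phi (x ^+ n)) (phi x).
Proof.
move=> /andP[p0 p1] [_ bp].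
have bE r : phi (b ^+ r.+1) = p%:C by apply: bp.
have p0' : p%:C != 0 by rewrite -[0]/(0%:C) (inj_eq (@complexI _)) gt_eqF.
have p1' : p%:C != 1 by rewrite -[1]/(1%:C) (inj_eq (@complexI _)) lt_eqF.
apply: (@catalan_of_constant_moments _ (fun r => mom (x ^+ r))
  (fun r => mom (b ^+ r)) (fun r => phi (x ^+ r)) (fun r => phi (b ^+ r))) => //=.
- by move=> r; apply: mom_coef0.
- by move=> r; apply: mom_coef0.
- exact: (moment_series_powx phi1 free_xb).
- exact: (moment_series_powb phi1 free_xb).
- exact: split_series.
- by rewrite bE.
- by rewrite bE.
- by move=> r; rewrite !bE.
Qed.

Lemma constant_moments_of_poisson (al : R[i]) : al != 0 -> phi b != 0 ->
  catalan_type (fun n => phi (x ^+ n)) al ->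
  forall r, phi (b ^+ r.+1) = phi b.
Proof.
move=> al0 b0 cat.
have xal : phi x = al by have := cat 0%N; rewrite big_ord1 /= expr1 expr0 phi1 !mulr1.
apply: (@constant_moments_of_catalan _ (fun r => mom (x ^+ r))
  (fun r => mom (b ^+ r)) (fun r => phi (x ^+ r)) (fun r => phi (b ^+ r)) _ _ _ _ _ al) => //=.
- by move=> r; apply: mom_coef0.
- by move=> r; apply: mom_coef0.
- exact: (moment_series_powx phi1 free_xb).
- exact: (moment_series_powb phi1 free_xb).
- by have := split_series; rewrite xal.
Qed.

End Splitting.

Section ConstantMoments.
Context {R : realType} {A : algType R[i]}.
Variable phi : {scalar A}.
Hypothesis phi1 : phi 1 = 1.

(** [phi (f y) = f 1] for every polynomial [f]. *)
Lemma unit_moments_compl (y : A) :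
  (forall r, phi (y ^+ r) = 1) -> forall r, phi ((1 - y) ^+ r.+1) = 0.
Proof.
move=> y1 r; suff y0 k : phi ((1 - y) ^+ r.+1 * y ^+ k) = 0.
  by have := y0 0%N; rewrite expr0 mulr1.
elim: r k => [|r IH] k.
  by rewrite expr1 mulrBl mul1r -exprS linearB /= !y1 subrr.
by rewrite exprSr -mulrA mulrBl mul1r -exprS mulrBr linearB /= !IH subrr.
Qed.

(** A variable [b] of mean zero is replaced by [1 - b], whose mean is one. *)
Lemma constant_moments_free_split (x b : A) (al : R[i]) :
  free_pair phi x b -> free_pair phi (x * b) (x * (1 - b)) ->
  al != 0 -> catalan_type (fun n => phi (x ^+ n)) al ->
  forall n, (0 < n)%N -> phi (b ^+ n) = phi b.
Proof.
move=> fxb fsplit al0 cat [//|n] _.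
have [b0|] := eqVneq (phi b) 0; last first.
  by move=> b0; apply: (constant_moments_of_poisson phi1 fxb fsplit al0).
pose c := 1 - b; have bE : b = 1 - c by rewrite /c opprB addrC subrK.
have phic : phi c = 1 by rewrite linearB /= phi1 b0 subr0.
rewrite [b in LHS]bE b0; apply: unit_moments_compl => -[|r].
  by rewrite expr0.
rewrite -[RHS]phic; apply: (constant_moments_of_poisson phi1 _ _ al0 _ cat).
- exact: free_pair_compl.
- by rewrite -bE; apply: free_pairC.
- by rewrite phic oner_neq0.
Qed.

End ConstantMoments.

(** * Conclusion *)

(** The integral of [(t^2 - t)^2 = t^4 - 2 t^3 + t^2] is [be - 2 be + be = 0],
    so [nu] is carried by [0] and [1], and [t] is almost everywhere the
    indicator of [1]. *)
Lemma constant_moments_atom (R : realType)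
    (nu : probability (measurableTypeR R) R) (be : R) :
  (forall n, (0 < n)%N ->
     nu.-integrable setT (fun t : measurableTypeR R => ((t : R) ^+ n)%:E) /\
     Rintegral nu setT (fun t : measurableTypeR R => (t : R) ^+ n) = be) ->
  be = fine (nu [set 1]).
Proof.
move=> mom.
pose e n (t : measurableTypeR R) : R := (t : R) ^+ n.
have eI n : (0 < n)%N -> nu.-integrable setT (EFin \o e n) by move=> /mom[].
have eM n : (0 < n)%N -> Rintegral nu setT (e n) = be by move=> /mom[].
pose q t := e 4 t - 2 * e 3 t + e 2 t.
have mT : measurable [set: measurableTypeR R] by [].
have e2 := eI 2 isT; have e3 := eI 3 isT; have e4 := eI 4 isT.
have i2e3 : nu.-integrable setT (EFin \o (fun t => 2 * e 3 t)).
  by apply: (eq_integrable mT _ _ _ (integrableZl mT 2 e3)) => t _; rewrite /= EFinM.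
have i42 : nu.-integrable setT (EFin \o (fun t => e 4 t - 2 * e 3 t)).
  by apply: (eq_integrable mT _ _ _ (integrableB mT e4 i2e3)).
have iq : nu.-integrable setT (EFin \o q).
  by apply: (eq_integrable mT _ _ _ (integrableD mT i42 e2)).
have q0 : Rintegral nu setT q = 0.
  rewrite (RintegralD mT i42 e2) (RintegralB mT e4 i2e3) (RintegralZl 2 mT e3).
  by rewrite !eM //; ring.
have qE t : q t = (e 1 t ^+ 2 - e 1 t) ^+ 2 by rewrite /q /e expr1; ring.
have /ae_eq_integral_abs : (\int[nu]_(t in setT) `|(EFin \o q) t| = 0)%E.
  under eq_integral do rewrite /= ger0_norm ?qE ?sqr_ge0 // -qE.
  by rewrite -[LHS]fineK ?(integrable_fin_num mT iq) // -/(Rintegral nu setT q) q0.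
move=> /(_ mT (measurable_int _ iq)) ae0.
rewrite -(eM 1%N) // /Rintegral; congr fine.
rewrite (_ : nu [set 1] =
  (\int[nu]_(t in setT) (\1_[set (1 : measurableTypeR R)%R] t)%:E)%E); last first.
  by rewrite integral_indic ?setIT.
apply: ae_eq_integral => //.
- exact: (measurable_int _ (eI 1%N _)).
- by apply/measurable_EFinP; exact: measurable_indic.
apply: filterS ae0 => t /= + _ => /(_ I) [] /eqP.
rewrite qE sqrf_eq0 subr_eq0 expr2 -subr_eq0 -{3}[e 1 t]mulr1 -mulrBr mulf_eq0 subr_eq0.
have tE : e 1 t = t by rewrite /e expr1.
rewrite indicE => /orP[] /eqP e1t; rewrite e1t; congr (_%:E).
  rewrite memNset //= => t1; move/eqP: e1t.
  by rewrite tE t1 oner_eq0.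
by rewrite mem_set // -[LHS]tE.
Qed.

Theorem theorem4p4 (R : realType) (A : algType R[i]) (phi : {scalar A})
    (phi1 : phi 1 = 1) (x b : A)
    (free_xb : free_pair phi x b)
    (free_split : free_pair phi (x * b) (x * (1 - b))) :
  (forall p : R, 0 < p < 1 -> bernoulli_variable phi b p -> 0 < phi x ->
     free_poisson phi x 1 (phi x))
  /\
  (free_poisson_rate phi x 1 ->
     (forall n : nat, (0 < n)%N -> phi (b ^+ n) = phi b)
     /\
     (forall nu : probability (measurableTypeR R) R,
        has_moments_of phi b nu ->
        bernoulli_variable phi b (fine (nu [set 1])))
     /\
     (forall star : A -> A,
        star_operation star -> star_positive star phi ->
        star_faithful star phi -> self_adjoint star b ->
        projection star b)).
Proof.
split=> [p p01 bernb x0 | [al [_ al0 poi]]].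
  split=> //= n n0; rewrite mul1r.
  apply: (proj2 (geometric_cumulantsP phi1 x (phi x))) => //.
  exact: (catalan_of_bernoulli phi1 free_xb free_split p01 bernb).
have bconst : forall n, (0 < n)%N -> phi (b ^+ n) = phi b.
  apply: (@constant_moments_free_split _ _ _ phi1 x b al) => //.
    by rewrite gt_eqF.
  apply: (proj1 (geometric_cumulantsP phi1 x al)) => n n0.
  by rewrite poi // mul1r.
split=> //; split=> [nu mom | star [_ starD _ starM] _ faith bstar].
  have momE n : (0 < n)%N -> phi (b ^+ n) =
      (Rintegral nu setT (fun t : measurableTypeR R => (t : R) ^+ n))%:C.
    by move=> /mom[].
  set be := Rintegral nu setT (fun t : measurableTypeR R => (t : R) ^+ 1).
  have beE : be = fine (nu [set 1]).
    apply: constant_moments_atom => n n0; split; first by case: (mom n n0).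
    by apply: (@complexI R); rewrite -!momE // !bconst.
  split; last by move=> n n0; rewrite -beE -momE // !bconst.
  rewrite fine_ge0 //= -lee_fin fineK ?probability_le1 //.
  by rewrite fin_num_measure.
split=> //; apply/eqP; rewrite -subr_eq0; apply/eqP; apply: faith.
have star0 : star 0 = 0 by apply: (@addrI _ (star 0)); rewrite -starD !addr0.
have starN y : star (- y) = - star y.
  by apply: (@addrI _ (star y)); rewrite -starD !subrr.
rewrite starD starN starM bstar.
have -> : (b * b - b) * (b * b - b) = b ^+ 4 - b ^+ 3 - (b ^+ 3 - b ^+ 2).
  by rewrite mulrBr !mulrBl !exprS expr0 mulr1 !mulrA.
by rewrite !linearB /= !bconst // subrr opprK addNr addr0.
Qed.
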